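(* To every finite-dimensional real vector space $V$ equipped with a weight $\varpi_V$ taking only negative values on $V\setminus\{0\}$ one can associate a finite-dimensional vector space $\mathbf V$ equipped with a weight $\varpi_{\mathbf V}$ taking non-positive values, a linear map $\Pi_V\colon \mathbf V\to V$, a polynomial map $\iota_V\colon V\to\mathbf V$, and, for subresonant polynomial maps $f$ as below, linear maps $\mathbf L f$, with the following properties. (1) $\mathbf V':=\{v\in\mathbf V:\varpi_{\mathbf V}(v)<0\}$ is a codimension-1 subspace of $\mathbf V$. (2) The image of $\iota_V$ is contained in the codimension-1 affine subspace $\iota_V(0)+\mathbf V'$. (3) For every $f\in\mathcal P^{SR}(V,V)$ there exists a linear map $\mathbf L f\colon\mathbf V\to\mathbf V$ such that $\iota_V\circ f=(\mathbf L f)\circ\iota_V$. (4) Let $\mathbf G^{SR}(\mathbf V)$, $\mathbf G^{SSR}(\mathbf V)$, $\mathbf G^{\ast}(\mathbf V)$ denote the images of $\mathcal G^{SR}(V)$, $\mathcal G^{SSR}(V)$, $\mathcal G^{\ast}(V)$, respectively, under $f\mapsto\mathbf L f$. Then these are subgroups of $\mathrm{GL}(\mathbf V)$ and the map $f\mapsto\mathbf L f$ determines a continuous isomorphism between Lie groups. (5) $\mathbf G^{\ast}(\mathbf V)$ and $\mathbf G^{SSR}(\mathbf V)$ are unipotent subgroups of $\mathbf G^{SR}(\mathbf V)$. (6) $\Pi_V\circ\iota_V$ is the identity map of $V$. Let moreover $U$ and $W$ be finite-dimensional vector spaces equipped with weights compatible with the weight on $V$ (with associated data $\mathbf U,\iota_U,\dots$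 and $\mathbf W,\iota_W,\dots$). (7) For every $f\in\mathcal P^{SR}(V,W)$ there is a linear transformation $\mathbf L f\colon\mathbf V\to\mathbf W$ with $\iota_W\circ f=(\mathbf L f)\circ\iota_V$; moreover $\mathbf L f(\mathbf V')\subset\mathbf W'$. (8) Given $f\in\mathcal P^{SR}(V,W)$ and $g\in\mathcal P^{SR}(W,U)$, $\mathbf L(g\circ f)=(\mathbf L g)\circ(\mathbf L f)$. Let $\ell_V$ denote the span of $\iota_V(0)$ in $\mathbf V$ (and similarly $\ell_W\subset \mathbf W$). (9) An inner product on $V$ canonically defines an inner product on $\mathbf V$; relative to this inner product, $\iota_V(0)$ is a unit vector, $\ell_V$ is orthogonal to $\mathbf V'$, and $D_0\iota_V$ is an isometry onto its image. (10) If $f\in\mathcal P^{SR}(V,W)$ satisfies $f(0)=0$ then $\mathbf L f\colon\mathbf V\to\mathbf W$ induces a linear map between the quotients $\mathbf V/\ell_V\to\mathbf W/\ell_W$ (which, using the orthogonal projections $\mathbf V\to\mathbf V'$ and $\mathbf W\to\mathbf W'$ along $\ell_V$ and $\ell_W$, may be viewed as a map $\mathbf V'\to\mathbf W'$).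
   Context: All vector spaces are real and finite-dimensional. A weight on $V$ is a function $\varpi\colon V\to\mathbb R\cup\{-\infty\}$ with (i) $\varpi(v)=-\infty$ iff $v=0$; (ii) $\varpi(cv)=\varpi(v)$ for $c\in\mathbb R\setminus\{0\}$; (iii) $\varpi(v+w)\le\max\{\varpi(v),\varpi(w)\}$. On $V\setminus\{0\}$ it takes finitely many values $\lambda_1<\dots<\lambda_\ell$; put $V_{\le\lambda}=\{v:\varpi(v)\le\lambda\}$; the multiplicity of $\lambda_i$ is $\dim V_{\le\lambda_i}-\dim V_{\le\lambda_{i-1}}$ (with $V_{\le\lambda_0}=\{0\}$). Weights on two spaces are compatible if they take the same values with the same multiplicities. For a polynomial map $f\colon V\to W$ let $\tilde D^kf=\frac1{k!}D_0^kf$ be the symmetric $k$-multilinear map (polarization) of the degree-$k$ homogeneous component of $f$, with $\tilde D^0f=f(0)$. For a $k$-multilinear $T\colon V^{k}\to W$, $k\ge1$, put $\varpi(T)=\max\{\varpi_W(T(v_1,\dots,v_k))-\sum_i\varpi_V(v_i): v_1,\dots,v_k\ne0\}$; for $k=0$ (a constant $w_0\in W$) put $\varpi=\varpi_W(w_0)$. Put $\varpi(f)=\max_k\varpi(\tilde D^kf)$. $\mathcal P^{SR}(V,W)$ is the set of subresonant polynomial maps, i.e. those with $\varpi(f)\le0$; $\mathcal P^{SSR}(V,W)$ those with $\varpi(f)<0$; $\mathcal P^{\ast}(V,W)$ those $f\in\mathcal P^{SR}(V,W)$ with $\varpi(D_0f)<0$. $\mathcal G^{SR}(V)$ is the group (under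 composition) of $f\in\mathcal P^{SR}(V,V)$ with $D_0f$ invertible; $\mathcal G^{SSR}(V)$ (resp. $\mathcal G^{\ast}(V)$) is the subgroup of maps $x\mapsto x+f(x)$ with $f\in\mathcal P^{SSR}(V,V)$ (resp. $f\in\mathcal P^{\ast}(V,V)$). $\mathcal G^{SR}(V)$ is a finite-dimensional Lie group. ''Canonically'' in (9) means determined by $V$, its weight, and the given inner product only. *)

(* Defs.v *)
From HB Require Import structures.
From mathcomp Require Import all_boot all_order all_algebra all_fingroup.
From mathcomp Require Import all_classical all_reals all_analysis.

Set Implicit Arguments.
Unset Strict Implicit.
Unset Printing Implicit Defensive.

Import Order.TTheory GRing.Theory Num.Theory.
Import numFieldNormedType.Exports.
Local Open Scope classical_set_scope.
Local Open Scope ring_scope.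

Lemma vspace_of_setP (K : fieldType) (V : vectType K) (A : set V) :
    A 0 -> (forall c u v, A u -> A v -> A (c *: u + v)) ->
  exists U : {vspace V}, forall v, v \in U <-> A v.
Proof.
move=> A0 AD.
pose sub (U : {vspace V}) := forall v, v \in U -> A v.
pose P n := `[< exists2 U, sub U & \dim U = n >].
have P0 : exists n, P n.
  exists 0; apply/asboolP; exists 0%VS; last by rewrite dimv0.
  by move=> v; rewrite memv0 => /eqP ->.
have Pm n : P n -> (n <= \dim {:V})%N.
  by move=> /asboolP[U _ <-]; apply/dimvS/subvf.
case: (ex_maxnP P0 Pm) => n /asboolP[U sU dU] maxn.
exists U => v; split=> [/sU //|Av].
have sUv : sub (<[v]> + U)%VS.
  by move=> _ /memv_addP[_ /vlineP[c ->] [u /sU Au ->]]; apply: AD.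
have le : (\dim (<[v]> + U) <= \dim U)%N.
  by rewrite dU; apply: maxn; apply/asboolP; exists (<[v]> + U)%VS.
have /eqP -> : U == (<[v]> + U)%VS by rewrite eqEdim addvSr.
by apply: (subvP (addvSl _ U)); apply: memv_line.
Qed.

Section Weights.
Context {R : realType}.

Record weight (V : vectType R) := Weight {
  wt_fun :> V -> \bar R;
  wt_lty : forall v, (wt_fun v < +oo)%E;
  wt_eqNy : forall v, wt_fun v = -oo%E <-> v = 0;
  wtZ : forall c v, c != 0 -> wt_fun (c *: v) = wt_fun v;
  wtD : forall v w, (wt_fun (v + w) <= maxe (wt_fun v) (wt_fun w))%E }.

Lemma wt0 (V : vectType R) (w : weight V) : w 0 = -oo%E.
Proof. exact/wt_eqNy. Qed.

Lemma wtZ_le (V : vectType R) (w : weight V) c v : (w (c *: v) <= w v)%E.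
Proof.
have [->|c0] := eqVneq c 0; first by rewrite scale0r wt0 leNye.
by rewrite wtZ.
Qed.

Lemma wt_le_subproof (V : vectType R) (w : weight V) (lam : \bar R) :
  exists U : {vspace V}, forall v, v \in U <-> (w v <= lam)%E.
Proof.
apply: (@vspace_of_setP _ V [set v | (w v <= lam)%E]) => /=.
  by rewrite wt0 leNye.
move=> c u v hu hv; apply: (le_trans (wtD _ _ _)).
by rewrite ge_max hv andbT; apply: le_trans (wtZ_le _ _ _) hu.
Qed.

(* The strict sublevel of [-oo] is empty, hence the disjunct [v = 0]. *)
Lemma wt_lt_subproof (V : vectType R) (w : weight V) (lam : \bar R) :
  exists U : {vspace V}, forall v, v \in U <-> (v = 0 \/ (w v < lam)%E).
Proof.
apply: (@vspace_of_setP _ V [set v | v = 0 \/ (w v < lam)%E]) => /=.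
  by left.
move=> c u v [->|hu] [->|hv].
- by left; rewrite scaler0 add0r.
- by right; rewrite scaler0 add0r.
- by right; rewrite addr0; apply: le_lt_trans (wtZ_le _ _ _) hu.
- right; apply: (le_lt_trans (wtD _ _ _)).
  by rewrite gt_max hv andbT; apply: le_lt_trans (wtZ_le _ _ _) hu.
Qed.

Definition wt_le (V : vectType R) (w : weight V) (lam : \bar R) : {vspace V} :=
  projT1 (cid (wt_le_subproof w lam)).

Definition wt_lt (V : vectType R) (w : weight V) (lam : \bar R) : {vspace V} :=
  projT1 (cid (wt_lt_subproof w lam)).

Lemma wt_leP (V : vectType R) (w : weight V) lam v :
  v \in wt_le w lam <-> (w v <= lam)%E.
Proof. exact: (projT2 (cid (wt_le_subproof w lam)) v). Qed.

Lemma wt_ltP (V : vectType R) (w : weight V) lam v :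
  v \in wt_lt w lam <-> (v = 0 \/ (w v < lam)%E).
Proof. exact: (projT2 (cid (wt_lt_subproof w lam)) v). Qed.

Definition wt_values (V : vectType R) (w : weight V) : set (\bar R) :=
  [set w v | v in [set v | v != 0]].

(* When [lam] is a value of [w], [wt_lt w lam] is the sublevel space of the
   preceding value ({0} if there is none). *)
Definition wt_mult (V : vectType R) (w : weight V) (lam : \bar R) : nat :=
  (\dim (wt_le w lam) - \dim (wt_lt w lam))%N.

Definition compatible (V W : vectType R) (wV : weight V) (wW : weight W) :=
  wt_values wV = wt_values wW /\
  forall lam, wt_values wV lam -> wt_mult wV lam = wt_mult wW lam.

Structure wspace := WSpace { wspace_sort :> vectType R;
                             wt : weight wspace_sort }.

Definition neg_weight (V : wspace) := forall v : V, v != 0 -> (wt V v < 0)%E.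

Definition neg_part (V : wspace) : {vspace V} := wt_lt (wt V) 0%E.

End Weights.
Arguments wspace R : clear implicits.

Section PolynomialMaps.
Context {R : realType}.
Implicit Types V W : vectType R.

Definition multilinear_map V W k (T : ('I_k -> V) -> W) :=
  forall (v : 'I_k -> V) (i : 'I_k) (c : R) (x y : V),
    let T_i z := T (@dfwith _ (fun=> V) v i z) in
    T_i (c *: x + y) = c *: T_i x + T_i y.

Definition symmetric_map V W k (T : ('I_k -> V) -> W) :=
  forall (s : 'S_k) (v : 'I_k -> V), T (fun i => v (s i)) = T v.

(* [T k] polarizes the degree-[k] homogeneous component of [f]; such a family
   is unique because [R] has characteristic 0. *)
Definition polarization V W (f : V -> W) (T : forall k, ('I_k -> V) -> W) :=
  (forall k, multilinear_map (T k) /\ symmetric_map (T k)) /\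
  exists n, (forall k v, (n <= k)%N -> T k v = 0) /\
            (forall v, f v = \sum_(k < n) T k (fun=> v)).

Definition polynomial_map V W (f : V -> W) := exists T, polarization f T.

Definition Dtilde V W (f : V -> W) : forall k, ('I_k -> V) -> W :=
  match pselect (polynomial_map f) with
  | left h => projT1 (cid h)
  | right _ => fun _ _ => 0
  end.

Definition D0 V W (f : V -> W) (v : V) : W := @Dtilde V W f 1 (fun=> v).

End PolynomialMaps.

Section Subresonant.
Context {R : realType}.
Implicit Types V W : wspace R.

(* The set below is finite, so the supremum is a maximum, except that it is
   empty when [V] is zero and [0 < k]; then [T = 0] and the value is [-oo].
   For [k = 0] the sum is empty and this is the weight of the constant. *)
Definition wt_multi V W k (T : ('I_k -> V) -> W) : \bar R :=
  ereal_sup [set (wt W (T v) - \sum_(i < k) wt V (v i))%E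
            | v in [set v : 'I_k -> V | forall i, v i != 0]].

(* Almost all terms are [-oo], so this supremum is a maximum as well. *)
Definition wt_poly V W (f : V -> W) : \bar R :=
  ereal_sup [set wt_multi (Dtilde f (k := k)) | k in [set: nat]].

Definition PSR V W : set (V -> W) :=
  [set f | polynomial_map f /\ (wt_poly f <= 0)%E].

Definition PSSR V W : set (V -> W) :=
  [set f | polynomial_map f /\ (wt_poly f < 0)%E].

Definition Pstar V W : set (V -> W) :=
  [set f | PSR f /\ (wt_multi (Dtilde f (k := 1)) < 0)%E].

Definition GSR V : set (V -> V) := [set f | PSR f /\ bijective (D0 f)].

Definition GSSR V : set (V -> V) :=
  [set (fun x => x + f x) | f in @PSSR V V].

Definition Gstar V : set (V -> V) :=
  [set (fun x => x + f x) | f in @Pstar V V].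

End Subresonant.
Arguments PSR {R} V W.
Arguments PSSR {R} V W.
Arguments Pstar {R} V W.
Arguments GSR {R} V.
Arguments GSSR {R} V.
Arguments Gstar {R} V.

Section LieGroups.
Context {R : realType}.
Implicit Types V E : vectType R.

(* The usual topology of a finite-dimensional space, transported from row
   vectors by the coordinates in a basis (which basis does not matter). *)
Definition vtop V : Type :=
  initial_topology (passmx.rVof (vbasis {:V}) : V -> 'rV[R]_(\dim {:V})).
HB.instance Definition _ V := Topological.on (vtop V).

Definition GL V : set 'End(V) := [set g | lker g == 0%VS].

Definition GL_subgroup V (G : set 'End(V)) :=
  [/\ G `<=` @GL V, G \1%VF,
      forall g h, G g -> G h -> G (g \o h)%VF &
      forall g, G g -> G (g^-1)%VF].

(* Linear Lie groups are taken in the usual sense of closed subgroups of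
   GL(V), with the subspace topology. *)
Definition closed_GL_subgroup V (G : set 'End(V)) :=
  GL_subgroup G /\
  exists2 C : set (vtop 'End(V)), closed C & G = C `&` @GL V.

Definition unipotent V (G : set 'End(V)) :=
  forall g, G g -> exists n, forall v : V, iter n (fun x => g x - x) v = 0.

Definition composition_group (T : Type) (G : set (T -> T)) :=
  [/\ G id, forall f g, G f -> G g -> G (f \o g) &
      forall f, G f -> exists2 g, G g & cancel f g /\ cancel g f].

(* [G] stands for a group of subresonant maps, whose topology is induced by the
   finite-dimensional space [PSR V V]; the unique Hausdorff vector topology of
   such a space of maps is the one of pointwise convergence. An isomorphism of
   Lie groups is a group isomorphism continuous in both directions (it is then
   automatically smooth). *)
Definition Lie_isomorphism V E (G : set (V -> V)) (L : (V -> V) -> 'End(E)) :=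
  [/\ composition_group G, closed_GL_subgroup (L @` G),
      forall f g, G f -> G g -> L (f \o g) = (L f \o L g)%VF,
      {within (G : set {ptws V -> vtop V}),
        continuous (L : {ptws V -> vtop V} -> vtop 'End(E))} &
      exists2 Linv : 'End(E) -> V -> V, (forall f, G f -> Linv (L f) = f) &
        {within (L @` G : set (vtop 'End(E))),
          continuous (Linv : vtop 'End(E) -> {ptws V -> vtop V})}].

(* [pi] exhibits [Q] as the quotient of [V] by [U]. *)
Definition quotient_map V (U : {vspace V}) (Q : vectType R)
    (pi : 'Hom(V, Q)) := lker pi = U /\ limg pi = fullv.

End LieGroups.

(* Main.v *)
(* The space [lin V] is dual to the space of polynomial functions on [V] of
   weight at most [m], where [m] bounds the weights of all linear forms (for the
   weight on polynomial functions in which nonzero constants have weight [0]).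
   That space is finite-dimensional because the weight on [V] is negative, and
   it is stable under pullback by subresonant maps, since those are exactly the
   maps that pull back linear forms of weight at most [b] to polynomials of
   weight at most [b]. The map [iota_of] is evaluation, [lin_map f] is the
   transpose of the pullback by [f], and functoriality is immediate; constants
   give the hyperplane, linear forms give the projection.

   That a subresonant [f] with [D0 f] invertible has a subresonant inverse, and
   that [lin_map f] is unipotent when [f] is the identity plus a map in [Pstar],
   both follow by induction on the weight of linear forms: up to its linear part
   (resp. up to [phi]), [phi \o f] is a sum of products of polynomials of smaller
   weight. A group of subresonant maps is recovered inside [GL (lin V)] by the
   equations [iota (Pi (g (iota v))) = g (iota v)] and by linear conditions on
   [g], hence is closed there.

   For the inner product, [lin V] embeds into a coordinate space by the monomials
   in a basis that is orthonormal and adapted to the weight; the resulting kernel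
   [(x, y) |-> <iota x, iota y>] does not depend on that basis. *)
From HB Require Import structures.
Require Import Defs.
From mathcomp Require Import all_boot all_order all_algebra all_fingroup.
From mathcomp Require Import all_classical all_reals all_analysis.
From mathcomp Require Import ring lra.
Import Order.TTheory GRing.Theory Num.Theory.
Import numFieldNormedType.Exports.
Local Open Scope classical_set_scope.
Local Open Scope ring_scope.
Set Implicit Arguments.
Unset Strict Implicit.
Unset Printing Implicit Defensive.

(** * Inner products and bases adapted to a weight *)

(** The weight filtration on polynomials is generated inductively instead of being read off a
    maximum. Closure under sums, products and pullbacks is then immediate, and the work lies in
    extracting information from membership. Two devices do this: expansion into monomials of an
    adapted basis, and restriction to lines [t |-> v + t *: u], where coefficients of real
    polynomials in one variable are compared. A derivative in direction [u] lowers the weight by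
    [depth u], which ties the filtration to the weights of polarizations. The dual space is realised
    as the span of the points [iota_of v] in a space of monomial coordinates. Linear maps out of it
    are determined by their values on these points, and every map of bounded weight extends, so
    identities are checked on points only. Monomials are indexed by ordered words: the kernel is
    then a polynomial in the inner products of the components of [x] and [y] of each depth, which no
    longer mention a basis. *)

Section LinearForms.
Context {R : realType}.
Implicit Types V W : vectType R.

Lemma linear_lfun V W (f : V -> W) : linear f ->
  exists T : 'Hom(V, W), forall v, T v = f v.
Proof.
move=> fl; pose g : {linear V -> W} := HB.pack f (GRing.isLinear.Build R V W *:%R f fl).
by exists (linfun g) => v; rewrite lfunE.
Qed.

Lemma scalar_pack V (phi : V -> R) : scalar phi -> exists g : {scalar V}, phi = g.
Proof.
move=> fl; pose g : {scalar V} := HB.pack phi (GRing.isLinear.Build R V R *%R phi fl).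
by exists g.
Qed.

Lemma scalar_lin V (phi : V -> R) : scalar phi ->
  [/\ phi 0 = 0, (forall u v, phi (u + v) = phi u + phi v),
      (forall u v, phi (u - v) = phi u - phi v),
      (forall c v, phi (c *: v) = c * phi v) &
      forall (I : Type) (r : seq I) (F : I -> V),
        phi (\sum_(i <- r) F i) = \sum_(i <- r) phi (F i)].
Proof.
move=> /scalar_pack[g ->]; split=> *.
- exact: linear0.
- exact: linearD.
- exact: linearB.
- exact: linearZ.
- exact: linear_sum.
Qed.

Lemma scalar_hom V (psi : 'Hom(V, R^o)) : scalar psi.
Proof. by move=> c u v; rewrite linearP. Qed.

Lemma scalar_lincomb V (phi psi : V -> R) a :
  scalar phi -> scalar psi -> scalar (fun v => a * phi v + psi v).
Proof. by move=> hp hq c u v; rewrite hp hq !mulrDr; ring. Qed.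

Lemma scalar_coord V (X : (\dim {: V}).-tuple V) i : scalar (coord X i).
Proof. by move=> c u v; rewrite linearP. Qed.

Lemma scalar_comp V W (phi : W -> R) (f : V -> W) :
  scalar phi -> linear f -> scalar (phi \o f).
Proof. by move=> hp hf c u v; rewrite /= hf hp. Qed.

Lemma scalar_separates V (u v : V) :
  (forall phi : V -> R, scalar phi -> phi u = phi v) -> u = v.
Proof.
move=> uv; rewrite (coord_vbasis (memvf u)) (coord_vbasis (memvf v)).
by apply: eq_bigr => i _; rewrite (uv _ (scalar_coord _ i)).
Qed.

End LinearForms.

Section InnerProducts.
Context {R : realType}.
Implicit Types V W : vectType R.

Lemma dotC V (d : {dot V for idfun}) u v : d u v = d v u.
Proof. by have := @hermitian_subproof _ _ _ _ d u v; rewrite expr0 mul1r. Qed.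

Lemma dot_scalar V (d : {dot V for idfun}) u : scalar (d u).
Proof. by move=> c x y; rewrite linearDr linearZr. Qed.

Lemma dot_linr V (d : {dot V for idfun}) u :
  [/\ d u 0 = 0, (forall v w, d u (v + w) = d u v + d u w),
      (forall v w, d u (v - w) = d u v - d u w),
      (forall c v, d u (c *: v) = c * d u v) &
      forall (I : Type) (r : seq I) (F : I -> V),
        d u (\sum_(i <- r) F i) = \sum_(i <- r) d u (F i)].
Proof. exact/scalar_lin/dot_scalar. Qed.

Lemma dot0r V (d : {dot V for idfun}) u : d u 0 = 0.
Proof. by case: (dot_linr d u). Qed.

Lemma dotDr V (d : {dot V for idfun}) u v w : d u (v + w) = d u v + d u w.
Proof. by case: (dot_linr d u). Qed.

Lemma dotBr V (d : {dot V for idfun}) u v w : d u (v - w) = d u v - d u w.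
Proof. by case: (dot_linr d u). Qed.

Lemma dotZr V (d : {dot V for idfun}) u c v : d u (c *: v) = c * d u v.
Proof. by case: (dot_linr d u). Qed.

Lemma dot_of_form V (f : V -> V -> R) :
    (forall u, scalar (f u)) -> (forall u v, f u v = f v u) ->
    (forall u, u != 0 -> 0 < f u u) ->
  exists d : {dot V for idfun}, forall u v, d u v = f u v.
Proof.
move=> fl fC f_gt0.
have fr u' : scalar (f ^~ u') by move=> c u v; rewrite !(fC _ u') fl.
pose m1 := isBilinear.Build R V V R *%R (idfun \; *%R) f
  (fun u' => zmod_morphism_linear (fr u')) (fun u => zmod_morphism_linear (fl u))
  (fun u' => scalable_linear (fr u')) (fun u => scalable_linear (fl u)).
have fH x y : f x y = (-1) ^+ false * idfun (f y x) by rewrite expr0 mul1r fC.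
pose m2 := isHermitianSesquilinear.Build R V false idfun f fH.
pose m3 := isDotProduct.Build R V f f_gt0.
pose d : {dot V for idfun} := HB.pack f m1 m2 m3.
by exists d.
Qed.

Lemma dot_pullback V m (T : 'Hom(V, 'rV[R]_m)) : lker T = 0%VS ->
  exists d : {dot V for idfun}, forall u v, d u v = \sum_j T u 0 j * T v 0 j.
Proof.
move=> /eqP kT; apply: dot_of_form => [u c x y|u v|u u0].
- rewrite mulr_sumr -big_split /=; apply: eq_bigr => j _.
  by rewrite linearP !mxE; ring.
- by apply: eq_bigr => j _; rewrite mulrC.
- rewrite lt_neqAle sumr_ge0 ?andbT => [|j _]; last by rewrite -expr2 sqr_ge0.
  apply: contra u0 => /eqP/esym/eqP; rewrite psumr_eq0 => [/allP h|j _]; last first.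
    by rewrite -expr2 sqr_ge0.
  rewrite -(inj_eq (lker0P kT)) linear0; apply/eqP/rowP => j; rewrite mxE.
  by have := h j (mem_index_enum _); rewrite mulf_eq0 orbb => /eqP.
Qed.

Lemma dot_exists V : exists d : {dot V for idfun}, True.
Proof.
have [] := @linear_lfun R V _ (fun v : V => passmx.rVof (vbasis {:V}) v).
  by move=> c u v; apply/rowP => i; rewrite !mxE linearP.
move=> T hT.
have kT : lker T = 0%VS.
  apply/eqP/lker0P => u v; rewrite !hT => huv.
  apply: scalar_separates => phi /scalar_lin[_ _ _ hZ hs].
  rewrite (coord_vbasis (memvf u)) (coord_vbasis (memvf v)) !hs.
  apply: eq_bigr => i _; rewrite !hZ; congr (_ * _).
  by have := congr1 (fun M : 'rV__ => M 0 i) huv; rewrite !mxE.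
by have [d _] := dot_pullback kT; exists d.
Qed.

(** An arbitrary inner product, used wherever some adapted basis has to be fixed. *)
Definition std_dot V : {dot V for idfun} := projT1 (cid (dot_exists V)).

End InnerProducts.

Section AdaptedBases.
Context {R : realType}.
Implicit Types V W : wspace R.

(** The set of values is not known to be finite at this point, so the minimum is taken over the
    dimensions of sublevel spaces: a smaller weight gives a strictly smaller sublevel space. *)
Lemma min_weight_vector V (U : {vspace V}) : U != 0%VS ->
  exists e, [/\ e \in U, e != 0 & forall v, v \in U -> v != 0 -> (wt V e <= wt V v)%E].
Proof.
move=> U0.
pose P n := `[< exists v, [/\ v \in U, v != 0 & \dim (wt_le (wt V) (wt V v)) = n] >].
have exP : exists n, P n.
  exists (\dim (wt_le (wt V) (wt V (vpick U)))); apply/asboolP.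
  by exists (vpick U); rewrite memv_pick vpick0.
case: (ex_minnP exP) => n /asboolP[e [eU e0 <-]] minn.
exists e; split=> // v vU v0; rewrite leNgt; apply/negP => lt_ve.
have sub : (wt_le (wt V) (wt V v) <= wt_le (wt V) (wt V e))%VS.
  by apply/subvP => x /wt_leP hx; apply/wt_leP/(le_trans hx)/ltW.
have := minn (\dim (wt_le (wt V) (wt V v))).
have -> : P (\dim (wt_le (wt V) (wt V v))) by apply/asboolP; exists v.
move=> /(_ isT); rewrite leqNgt => /negP; apply.
rewrite (ltn_leqif (dimv_leqif_sup sub)); apply/negP => /subvP/(_ e).
have -> : e \in wt_le (wt V) (wt V e) by apply/wt_leP.
by move=> /(_ isT)/wt_leP; rewrite leNgt lt_ve.
Qed.

(** Gram-Schmidt from a vector of least weight, followed by induction on its orthogonal complement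
    in [U]. The last clause bounds the weight of the coordinate form [d e]; it survives the
    induction because subtracting a multiple of a vector of least weight does not raise the
    weight. *)
Lemma adapted_basis_exists V (d : {dot V for idfun}) : exists s : seq V,
  [/\ uniq s, (forall e f, e \in s -> f \in s -> d e f = (e == f)%:R),
      (forall v, v = \sum_(e <- s) d e v *: e) &
      forall e v, e \in s -> d e v != 0 -> (wt V e <= wt V v)%E].
Proof.
suff H n (U : {vspace V}) : (\dim U < n)%N -> exists s : seq V,
  [/\ {subset s <= U}, uniq s,
      (forall e f, e \in s -> f \in s -> d e f = (e == f)%:R),
      (forall v, v \in U -> v = \sum_(e <- s) d e v *: e) &
      forall e v, e \in s -> v \in U -> d e v != 0 -> (wt V e <= wt V v)%E].
  have [s [_ s1 s2 s3 s4]] := H _ _ (ltnSn (\dim {: V})).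
  exists s; split=> // [v|e v es]; first by apply: s3; rewrite memvf.
  by apply: s4; rewrite ?memvf.
elim: n U => // n IH U ltUn; have [->|U0] := eqVneq U 0%VS.
  exists [::]; split=> // v; rewrite memv0 => /eqP ->; by rewrite big_nil.
have [e0 [e0U e00 e0min]] := min_weight_vector U0.
have n0 : 0 < d e0 e0 by apply: neq0_dnorm_gt0.
have s0 : (Num.sqrt (d e0 e0))^-1 != 0 by rewrite invr_eq0 sqrtr_eq0 -ltNge.
pose e := (Num.sqrt (d e0 e0))^-1 *: e0.
have eU : e \in U by rewrite rpredZ.
have ee : d e e = 1.
  rewrite /e dotZr (dotC d _ e0) dotZr mulrA -invfM -expr2.
  by rewrite sqr_sqrtr ?ltW// mulVf // gt_eqF.
have wte v : v \in U -> v != 0 -> (wt V e <= wt V v)%E.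
  by rewrite wtZ //; exact: e0min.
have [] := @vspace_of_setP _ V [set v | v \in U /\ d e v = 0].
- by rewrite /= mem0v dot0r.
- move=> c u v [uU du] [vU dv]; split; first by rewrite rpredD // rpredZ.
  by rewrite dotDr dotZr du dv mulr0 addr0.
move=> U' hU'.
have sU : (U' <= U)%VS by apply/subvP => v /hU'[].
have ltU' : (\dim U' < n)%N.
  rewrite ltnS in ltUn; apply: leq_trans ltUn; rewrite (ltn_leqif (dimv_leqif_sup sU)).
  by apply/negP => /subvP/(_ e eU)/hU'[_ /eqP]; rewrite ee oner_eq0.
have [s [s0' s1 s2 s3 s4]] := IH _ ltU'.
have es v : v \in s -> d e v = 0 by move=> /s0'/hU'[].
have eNs : e \notin s by apply/negP => /es/eqP; rewrite ee oner_eq0.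
have vU' v : v \in U -> v - d e v *: e \in U'.
  move=> vU; apply/hU'; split; first by rewrite rpredB // rpredZ.
  by rewrite dotBr dotZr ee mulr1 subrr.
have fv f v : f \in s -> d f (v - d e v *: e) = d f v.
  by move=> fs; rewrite dotBr dotZr (dotC d f e) (es f) // mulr0 subr0.
exists (e :: s); split.
- by move=> v; rewrite inE => /predU1P[->//|/s0'/(subvP sU)].
- by rewrite /= eNs.
- move=> x y; rewrite !inE => /predU1P[->|xs] /predU1P[->|ys].
  + by rewrite ee eqxx.
  + by rewrite es //; case: eqP eNs => // ->; rewrite ys.
  + by rewrite dotC es //; case: eqP eNs => // <-; rewrite xs.
  + exact: s2.
- move=> v vU; rewrite big_cons addrC; apply/eqP; rewrite -subr_eq; apply/eqP.
  rewrite {1}(s3 _ (vU' v vU)); apply: eq_big_seq => f fs.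
  by rewrite fv.
- move=> f v; rewrite inE => /predU1P[->|fs] vU dv.
    by apply: wte => //; apply: contraNneq dv => ->; rewrite dot0r.
  have v0 : v != 0 by apply: contraNneq dv => ->; rewrite dot0r.
  apply: (le_trans (s4 f (v - d e v *: e) fs (vU' v vU) _)); first by rewrite fv.
  apply: (le_trans (wtD _ _ _)); rewrite ge_max lexx /= -scaleNr.
  exact: le_trans (wtZ_le _ _ _) (wte _ vU v0).
Qed.

Definition adapted_basis V (d : {dot V for idfun}) : seq V :=
  projT1 (cid (adapted_basis_exists d)).

Section Basis.
Variables (V : wspace R) (d : {dot V for idfun}).
Notation s := (adapted_basis d).

Lemma adapted_basis_uniq : uniq s.
Proof. by have [] := projT2 (cid (adapted_basis_exists d)). Qed.

Lemma adapted_basis_ortho e f : e \in s -> f \in s -> d e f = (e == f)%:R.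
Proof. by have [_ h _ _] := projT2 (cid (adapted_basis_exists d)); exact: h. Qed.

Lemma adapted_basis_sum v : v = \sum_(e <- s) d e v *: e.
Proof. by have [_ _ h _] := projT2 (cid (adapted_basis_exists d)); exact: h. Qed.

Lemma adapted_basis_wt e v : e \in s -> d e v != 0 -> (wt V e <= wt V v)%E.
Proof. by have [_ _ _ h] := projT2 (cid (adapted_basis_exists d)); exact: h. Qed.

Lemma adapted_basis_neq0 e : e \in s -> e != 0.
Proof.
move=> es; apply/eqP => e0; have := adapted_basis_ortho es es.
by rewrite {2}e0 dot0r eqxx => /esym/eqP; rewrite oner_eq0.
Qed.

Lemma scalar_adapted_basis (phi : V -> R) v : scalar phi ->
  phi v = \sum_(e <- s) d e v * phi e.
Proof.
move=> /scalar_lin[_ _ _ hZ hs]; rewrite {1}(adapted_basis_sum v) hs.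
by apply: eq_bigr => e _; rewrite hZ.
Qed.

Lemma wt_le_adapted v lam :
    (forall e, e \in s -> d e v != 0 -> (wt V e <= lam)%E) ->
  (wt V v <= lam)%E.
Proof.
move=> h; rewrite (adapted_basis_sum v) big_seq.
apply: (big_ind (fun w => (wt V w <= lam)%E)).
- by rewrite wt0 leNye.
- by move=> x y hx hy; apply: (le_trans (wtD _ _ _)); rewrite ge_max hx.
move=> e es; have [->|dv] := eqVneq (d e v) 0; first by rewrite scale0r wt0 leNye.
by rewrite (wtZ _ _ dv) h.
Qed.

End Basis.
End AdaptedBases.

(** * Polynomial functions of bounded weight *)

Lemma count_sub_lt (T : eqType) (a b : pred T) (s : seq T) x : subpred a b ->
  x \in s -> b x -> ~~ a x -> (count a s < count b s)%N.
Proof.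
move=> ab + bx ax; elim: s => // y s IH; rewrite inE => /predU1P[<-|/IH lt_s] /=.
  by rewrite bx (negbTE ax) add0n add1n ltnS sub_count.
by rewrite -addnS; apply: leq_add lt_s; case ay: (a y) => //; rewrite (ab _ ay).
Qed.

Section WeightedPolynomials.
Context {R : realType}.
Implicit Types V W U : wspace R.

(** Positive on nonzero vectors when the weight is negative. At [0] the value is junk, whence the
    conditions [v != 0] below. *)
Definition depth V (v : V) : R := - fine (wt V v).

Lemma wt_depth V (v : V) : v != 0 -> wt V v = (- depth v)%:E.
Proof.
move=> v0; rewrite /depth opprK fineK // fin_numE; apply/andP; split.
  by apply: contra v0 => /eqP/wt_eqNy ->.
by apply/eqP => h; have := wt_lty (wt V) v; rewrite h.
Qed.

Lemma depth_gt0 V (v : V) : neg_weight V -> v != 0 -> 0 < depth v.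
Proof. by move=> nV v0; have := nV v v0; rewrite wt_depth // lte_fin oppr_lt0. Qed.

(** The weight of [phi] as a map to [R], nonzero numbers having weight [0], is at most [b]: [phi]
    vanishes on vectors of weight below [- b]. *)
Definition form_le V (b : R) (phi : V -> R) :=
  scalar phi /\ forall v, phi v != 0 -> ((- b)%:E <= wt V v)%E.

Lemma form_le_depth V b (phi : V -> R) v : form_le b phi -> phi v != 0 -> depth v <= b.
Proof.
move=> [hl hp] v0; have := hp v v0; rewrite wt_depth ?lee_fin ?lerN2 //.
by apply: contraNneq v0 => ->; case: (scalar_lin hl) => ->.
Qed.

Lemma form_leP V b (phi : V -> R) : scalar phi ->
  (forall v, phi v != 0 -> depth v <= b) -> form_le b phi.
Proof.
move=> hl h; split=> // v v0; rewrite wt_depth ?lee_fin ?lerN2 ?h //.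
by apply: contraNneq v0 => ->; case: (scalar_lin hl) => ->.
Qed.

Lemma form_le0 V b : form_le b (fun _ : V => 0).
Proof. by apply: form_leP => [c u v|v]; rewrite ?eqxx // mulr0 addr0. Qed.

Lemma form_le_eq0 V b (phi : V -> R) : neg_weight V -> b <= 0 -> form_le b phi ->
  forall v, phi v = 0.
Proof.
move=> nV b0 hp v; apply/eqP; apply: contraLR b0 => v0; rewrite -ltNge.
apply: lt_le_trans (form_le_depth hp v0); apply: depth_gt0 => //.
by apply: contraNneq v0 => ->; case: hp => /scalar_lin[->].
Qed.

Lemma form_le_dot V (d : {dot V for idfun}) e : e \in adapted_basis d ->
  form_le (depth e) (d e).
Proof.
move=> es; split; first exact: dot_scalar.
by move=> v /(adapted_basis_wt es); rewrite wt_depth // (adapted_basis_neq0 es).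
Qed.

(* [wpoly c] is the space of polynomial functions of weight at most [c], for the
   weight on [R] that vanishes on nonzero numbers. *)
Inductive wpoly V : R -> (V -> R) -> Prop :=
| wpoly_cst c k : 0 <= c -> wpoly c (fun _ => k)
| wpoly_add c p q : wpoly c p -> wpoly c q -> wpoly c (fun v => p v + q v)
| wpoly_form b c c' phi p : form_le b phi -> wpoly c' p -> b + c' <= c ->
    wpoly c (fun v => phi v * p v).

Lemma wpoly_ext V c (p q : V -> R) : (forall v, p v = q v) -> wpoly c p -> wpoly c q.
Proof. by move=> /funext ->. Qed.

Lemma wpoly_lin V b (phi : V -> R) : form_le b phi -> wpoly b phi.
Proof.
move=> hp; apply: (@wpoly_ext _ _ (fun v => phi v * 1)) => [v|]; first by rewrite mulr1.
by apply: (wpoly_form hp (wpoly_cst _ 1 (lexx 0))); rewrite addr0.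
Qed.

(** Constants are available only for [0 <= c]; for negative [c] zero is obtained as a linear
    form. *)
Lemma wpoly0 V c : wpoly c (fun _ : V => 0).
Proof. exact/wpoly_lin/form_le0. Qed.

Lemma wpoly_le V b c (p : V -> R) : b <= c -> wpoly b p -> wpoly c p.
Proof.
move=> bc hp; elim: hp c bc => {b p} [b k b0|b p q _ IHp _ IHq|a b b' phi p hphi hp _ le_b] c bc.
- exact/wpoly_cst/(le_trans b0).
- by apply: wpoly_add; [apply: IHp|apply: IHq].
- by apply: (wpoly_form hphi hp); apply: le_trans bc.
Qed.

Lemma wpoly_scale V c k (p : V -> R) : wpoly c p -> wpoly c (fun v => k * p v).
Proof.
elim=> {c p} [c a c0|c p q _ IHp _ IHq|b c c' phi p hphi _ IH le_c].
- exact: wpoly_cst.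
- by apply: wpoly_ext (wpoly_add IHp IHq) => v; rewrite mulrDr.
- by apply: wpoly_ext (wpoly_form hphi IH le_c) => v; rewrite mulrCA.
Qed.

Lemma wpoly_mul V b c e (p q : V -> R) : wpoly b p -> wpoly c q -> b + c <= e ->
  wpoly e (fun v => p v * q v).
Proof.
move=> hp hq; elim: hp e => {b p} [b k b0|b p p' _ IHp _ IHp'|a b b' phi p hphi _ IH le_b] e le_e.
- by apply/wpoly_scale/(wpoly_le _ hq)/(le_trans _ le_e); rewrite lerDr.
- by apply: wpoly_ext (wpoly_add (IHp _ le_e) (IHp' _ le_e)) => v; rewrite mulrDl.
- apply: wpoly_ext (wpoly_form hphi (IH _ (lexx _)) _) => [v|]; first by rewrite mulrA.
  by apply: le_trans le_e; rewrite addrA lerD2r.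
Qed.

Lemma wpoly_sub V c (p q : V -> R) : wpoly c p -> wpoly c q -> wpoly c (fun v => p v - q v).
Proof.
move=> hp hq; apply: wpoly_ext (wpoly_add hp (wpoly_scale (-1) hq)) => v.
by rewrite mulN1r.
Qed.

Lemma wpoly_sum V c (I : Type) (r : seq I) (P : pred I) (F : I -> V -> R) :
  (forall i, P i -> wpoly c (F i)) -> wpoly c (fun v => \sum_(i <- r | P i) F i v).
Proof.
move=> hF; elim: r => [|i r IH].
  by apply: wpoly_ext (wpoly0 V c) => v; rewrite big_nil.
case Pi: (P i); last by apply: wpoly_ext IH => v; rewrite big_cons Pi.
by apply: wpoly_ext (wpoly_add (hF i Pi) IH) => v; rewrite big_cons Pi.
Qed.

Definition sr_map V W (f : V -> W) :=
  forall b phi, form_le b phi -> wpoly b (phi \o f).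

Lemma wpoly_comp V W (f : V -> W) c p : sr_map f -> wpoly c p -> wpoly c (p \o f).
Proof.
move=> hf; elim=> {c p} [c k c0|c p q _ IHp _ IHq|b c c' phi p hphi _ IH le_c].
- exact: wpoly_cst.
- exact: wpoly_add.
- by apply: (wpoly_mul (hf _ _ hphi) IH).
Qed.

Lemma sr_map_comp V W U (f : V -> W) (g : W -> U) :
  sr_map f -> sr_map g -> sr_map (g \o f).
Proof. by move=> hf hg b phi hphi; have := wpoly_comp hf (hg _ _ hphi). Qed.

Lemma sr_map_id V : sr_map (@id V).
Proof. by move=> b phi hphi; apply: wpoly_lin. Qed.

Definition monomial V (d : {dot V for idfun}) (w : seq V) (v : V) : R :=
  \prod_(e <- w) d e v.

Definition word_depth V (w : seq V) : R := \sum_(e <- w) depth e.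

Lemma wpoly_monomial V (d : {dot V for idfun}) w : {subset w <= adapted_basis d} ->
  wpoly (word_depth w) (monomial d w).
Proof.
elim: w => [|e w IH] sw; rewrite /word_depth /monomial.
  by apply: wpoly_ext (wpoly_cst V 1 _) => [v|]; rewrite big_nil.
have es : e \in adapted_basis d by apply: sw; rewrite mem_head.
have /IH hw : {subset w <= adapted_basis d} by move=> x xw; apply: sw; rewrite inE xw orbT.
rewrite big_cons; apply: wpoly_ext (wpoly_form (form_le_dot es) hw (lexx _)) => v.
by rewrite big_cons.
Qed.

(** Expanding every form in the adapted basis replaces arbitrary generators by monomials, whose
    depth is visible. *)
Lemma wpoly_words V (d : {dot V for idfun}) c p : wpoly c p ->
  exists2 S : seq (R * seq V),
    (forall x, x \in S -> {subset x.2 <= adapted_basis d} /\ word_depth x.2 <= c) &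
    forall v, p v = \sum_(x <- S) x.1 * monomial d x.2 v.
Proof.
elim=> {c p} [c k c0|c p q _ [S hS pE] _ [S' hS' qE]|b c c' phi p hphi _ [S hS pE] le_c].
- exists [:: (k, [::])] => [x|v].
    by rewrite inE => /eqP -> /=; split=> //; rewrite /word_depth big_nil.
  by rewrite big_seq1 /monomial /= big_nil mulr1.
- exists (S ++ S') => [x|v]; last by rewrite big_cat pE qE.
  by rewrite mem_cat => /orP[/hS|/hS'].
(* Letters with [phi e = 0] are dropped, since only the others are known to have depth at most
   [b]. *)
- exists [seq (phi e * x.1, e :: x.2) | e <- [seq e <- adapted_basis d | phi e != 0],
                                        x <- S] => [y|v].
    move=> /allpairsP[[e x] /= [ein xS ->]] /=.
    move: ein; rewrite mem_filter => /andP[phie es].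
    have [sx lex] := hS x xS; split.
      by move=> z; rewrite inE => /predU1P[->//|/sx].
    rewrite /word_depth big_cons; apply: le_trans le_c.
    by apply: lerD lex; apply: form_le_depth phie.
  rewrite big_allpairs_dep /= (scalar_adapted_basis d _ hphi.1) big_filter.
  rewrite mulr_suml big_mkcond /=.
  rewrite [RHS]big_mkcond /=; apply: eq_bigr => e _.
  case: eqVneq => [->|_] /=; first by rewrite mulr0 mul0r.
  rewrite pE mulr_sumr; apply: eq_bigr => x _.
  by rewrite /monomial big_cons; ring.
Qed.

Lemma mem_word_depth V (d : {dot V for idfun}) w e : neg_weight V ->
  {subset w <= adapted_basis d} -> e \in w -> depth e <= word_depth w.
Proof.
move=> nV; rewrite /word_depth; elim: w => // f w IH sw.
have f0 : 0 <= depth f.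
  by apply/ltW/depth_gt0/(@adapted_basis_neq0 _ _ d); rewrite ?sw ?mem_head.
have sw' : {subset w <= adapted_basis d} by move=> x xw; apply: sw; rewrite inE xw orbT.
rewrite inE big_cons => /predU1P[->|ew]; last by apply: (le_trans (IH sw' ew)); rewrite lerDr.
rewrite lerDl big_seq sumr_ge0 // => i iw.
by apply/ltW/depth_gt0/(@adapted_basis_neq0 _ _ d); rewrite ?sw'.
Qed.

Lemma word_depth_ge0 V (d : {dot V for idfun}) w : neg_weight V ->
  {subset w <= adapted_basis d} -> 0 <= word_depth w.
Proof.
move=> nV sw; rewrite /word_depth big_seq sumr_ge0 // => e ew.
by apply/ltW/depth_gt0/(@adapted_basis_neq0 _ _ d); rewrite ?sw.
Qed.

(* Linear forms are handled by induction on their weight, of which there are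
   finitely many; polynomials of weight less than [b] only involve linear
   forms of weight less than [b]. *)
Lemma wpoly_algebra_ind V (Q : R -> (V -> R) -> Prop) : neg_weight V ->
    (forall c, Q c (fun _ => 0)) ->
    (forall c k, 0 <= c -> Q c (fun _ => k)) ->
    (forall c p q, Q c p -> Q c q -> Q c (fun v => p v + q v)) ->
    (forall b c e p q, Q b p -> Q c q -> b + c <= e -> Q e (fun v => p v * q v)) ->
    (forall b phi, form_le b phi -> (forall c p, c < b -> wpoly c p -> Q c p) -> Q b phi) ->
  forall c p, wpoly c p -> Q c p.
Proof.
move=> nV Q0 Qk QD QM Qlin; pose d := std_dot V; pose s := adapted_basis d.
have Qword w c : (forall e, e \in w -> Q (depth e) (d e)) -> word_depth w <= c ->
    Q c (monomial d w).
  elim: w c => [|e w IH] c hw le_c.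
    have -> : monomial d [::] = fun _ => 1 by apply/funext => v; rewrite /monomial big_nil.
    by apply: Qk; rewrite /word_depth big_nil in le_c.
  have -> : monomial d (e :: w) = fun v => d e v * monomial d w v.
    by apply/funext => v; rewrite /monomial big_cons.
  apply: (QM (depth e) (word_depth w)).
  - by apply: hw; rewrite mem_head.
  - by apply: IH => // f fw; apply: hw; rewrite inE fw orbT.
  - by rewrite /word_depth big_cons in le_c.
have Qwords c p : (forall e, e \in s -> depth e <= c -> Q (depth e) (d e)) ->
    wpoly c p -> Q c p.
  move=> hs /(wpoly_words d)[S hS /funext ->]; elim: S hS => [|x S IH] hS.
    by have -> // : (fun v : V => \sum_(x <- [::]) x.1 * monomial d x.2 v) = fun _ => 0
      by apply/funext => v; rewrite big_nil.
  have -> : (fun v : V => \sum_(x <- x :: S) x.1 * monomial d x.2 v) =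
      fun v => x.1 * monomial d x.2 v + \sum_(x <- S) x.1 * monomial d x.2 v.
    by apply/funext => v; rewrite big_cons.
  apply: QD; last by apply: IH => y yS; apply: hS; rewrite inE yS orbT.
  have [sx le_x] := hS x (mem_head _ _).
  apply: (QM 0 (word_depth x.2)); [exact: Qk| |by rewrite add0r].
  apply: Qword => // e ex; apply: hs; first exact: sx.
  exact: le_trans (mem_word_depth nV sx ex) le_x.
have Qs e : e \in s -> Q (depth e) (d e).
  (* The number of basis vectors of smaller depth serves as the induction measure in place of the
     real number [depth e]. *)
  have [n] := ubnP (count (fun f => depth f < depth e) s).
  elim: n e => // n IH e lt_n es; apply: Qlin (form_le_dot es) _ => c p lt_c.
  apply: Qwords => f fs le_f; have lt_fe := le_lt_trans le_f lt_c.
  apply: IH => //; apply: leq_trans (ltnSE lt_n).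
  apply: (count_sub_lt _ fs) => // [f' /= /lt_trans|]; first exact.
  by rewrite /= ltxx.
by move=> c p; apply: Qwords => e es _; apply: Qs.
Qed.

End WeightedPolynomials.

(** * Multilinear maps and polarizations *)

Section MultilinearMaps.
Context {R : realType}.
Implicit Types V W : vectType R.

(** Arguments form a sequence so that they can be split, concatenated and permuted; the default [0]
    is read only when [l] is shorter than [k]. *)
Definition on_seq V W k (T : ('I_k -> V) -> W) (l : seq V) : W :=
  T (fun i => nth 0 l i).

Lemma on_seq_linear V W k (T : ('I_k -> V) -> W) l r c x y : multilinear_map T ->
    (size l + (size r).+1 = k)%N ->
  on_seq T (l ++ (c *: x + y) :: r) = c *: on_seq T (l ++ x :: r) + on_seq T (l ++ y :: r).
Proof.
move=> mT sz; have lt_lk : (size l < k)%N by rewrite -sz -addSnnS leq_addr.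
have E z : on_seq T (l ++ z :: r) =
    T (@dfwith _ (fun=> V) (fun i : 'I_k => nth 0 (l ++ 0 :: r) i) (Ordinal lt_lk) z).
  congr T; apply/funext => i; have [<-|ne] := eqVneq (Ordinal lt_lk) i.
    by rewrite dfwithin nth_cat ltnn subnn.
  rewrite dfwithout // !nth_cat; case: ltnP => // le_i.
  have : (i != size l :> nat) by rewrite eq_sym; apply: contra ne.
  by rewrite neq_ltn ltnNge le_i /= -subn_gt0; case: (i - size l)%N.
by rewrite !E mT.
Qed.

Lemma on_seq_linearZ V W k (T : ('I_k -> V) -> W) l r c x : multilinear_map T ->
    (size l + (size r).+1 = k)%N ->
  on_seq T (l ++ (c *: x) :: r) = c *: on_seq T (l ++ x :: r).
Proof.
move=> mT sz; have h0 := on_seq_linear 1 0 0 mT sz.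
rewrite scaler0 addr0 scale1r in h0.
have {h0} z0 : on_seq T (l ++ 0 :: r) = 0.
  by apply/eqP; rewrite -(subrr (on_seq T (l ++ 0 :: r))) {2}h0 addrK.
by have := on_seq_linear c x 0 mT sz; rewrite addr0 z0 addr0.
Qed.

Lemma on_seq_sum V W k (T : ('I_k -> V) -> W) l r (I : Type) (s : seq I) (a : I -> R)
    (F : I -> V) : multilinear_map T -> (size l + (size r).+1 = k)%N ->
  on_seq T (l ++ (\sum_(i <- s) a i *: F i) :: r) =
    \sum_(i <- s) a i *: on_seq T (l ++ F i :: r).
Proof.
move=> mT sz; elim: s => [|i s IH]; last by rewrite !big_cons on_seq_linear // IH.
by rewrite !big_nil -(scale0r 0) on_seq_linearZ // scale0r.
Qed.

Lemma on_seq_perm V W k (T : ('I_k -> V) -> W) l r : symmetric_map T ->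
  size r = k -> perm_eq l r -> on_seq T l = on_seq T r.
Proof.
move=> sT /eqP sz; rewrite -[r]/(val (Tuple sz)) => /tuple_permP[s ->].
rewrite /on_seq -[RHS](sT s); congr T; apply/funext => i.
by rewrite -tnth_nth tnth_mktuple (tnth_nth 0).
Qed.

Lemma on_seq_diag V W k (T : ('I_k -> V) -> W) v : on_seq T (nseq k v) = T (fun=> v).
Proof. by congr T; apply/funext => i; rewrite nth_nseq ltn_ord. Qed.

Lemma on_seq_codom V W k (T : ('I_k -> V) -> W) v :
  T v = on_seq T [seq v i | i <- enum 'I_k].
Proof.
congr T; apply/funext => i.
by rewrite (nth_map i) ?nth_ord_enum // size_enum_ord.
Qed.

Lemma on_seq_homog V W k (T : ('I_k -> V) -> W) l m t v : multilinear_map T ->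
  (size l + m = k)%N -> on_seq T (l ++ nseq m (t *: v)) = t ^+ m *: on_seq T (l ++ nseq m v).
Proof.
move=> mT; elim: m l => [|m IH] l sz; first by rewrite expr0 scale1r.
rewrite /= on_seq_linearZ ?size_nseq //.
have := IH (rcons l v); rewrite !cat_rcons size_rcons => ->; last by rewrite addSnnS.
by rewrite scalerA exprS.
Qed.

(** Splitting the first argument [v + t *: u] gives [q1 + 'X * q2], and symmetry merges the [m]
    linear terms. For [m = 0] the list with [u] is one entry too long, but its coefficient is
    [0]. *)
Lemma on_seq_derivative V W k (T : ('I_k -> V) -> W) l m u v (phi : W -> R) :
    scalar phi -> multilinear_map T -> symmetric_map T -> (size l + m = k)%N ->
  exists q : {poly R}, [/\ forall t, phi (on_seq T (l ++ nseq m (v + t *: u))) = q.[t],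
    q`_0 = phi (on_seq T (l ++ nseq m v)) &
    q`_1 = m%:R * phi (on_seq T (l ++ u :: nseq m.-1 v))].
Proof.
move=> phil mT sT; have [_ phiD _ phiZ _] := scalar_lin phil.
elim: m l => [|m IH] l sz.
  exists (phi (on_seq T l))%:P; split=> [t||]; rewrite ?cats0 ?hornerC ?coefC //=.
  by rewrite mul0r.
have szr x : (size (rcons l x) + m = k)%N by rewrite size_rcons addSnnS.
have [q1 [q1E q10 q11]] := IH _ (szr v).
have [q2 [q2E q20 q21]] := IH _ (szr u).
exists (q1 + 'X * q2); split=> [t||].
- rewrite addrC /= on_seq_linear ?size_nseq // phiD phiZ.
  by rewrite -!cat_rcons [t *: u + v]addrC q1E q2E hornerD hornerM hornerX addrC.
- by rewrite coefD coefXM addr0 q10 cat_rcons.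
- rewrite coefD coefXM /= q20 q11 !cat_rcons; case: m {IH szr q1E q10 q11 q2E q20 q21} sz.
    by move=> sz; rewrite mul0r add0r mul1r.
  move=> m sz; rewrite /= [in RHS]mulrSr mulrDl mul1r; congr (_ * phi _ + _).
  apply: on_seq_perm => //; first by rewrite size_cat /= size_nseq.
  rewrite perm_cat2l -[_ :: _ :: _]/([:: v; u] ++ nseq m v).
  by rewrite -[X in perm_eq _ X]/([:: u; v] ++ nseq m v) perm_cat2r (perm_catC [:: v] [:: u]).
Qed.

End MultilinearMaps.

Section RealPolynomials.
Context {R : realType}.

(** The difference has every natural number as a root. This makes coefficients along a line well
    defined. *)
Lemma poly_horner_inj (p q : {poly R}) : (forall t, p.[t] = q.[t]) -> p = q.
Proof.
move=> pq; apply/eqP; rewrite -subr_eq0; apply/negPn/negP => h.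
pose s := [seq (i%:R : R) | i <- iota 0 (size (p - q))].
have us : uniq s by rewrite map_inj_uniq ?iota_uniq // => i j /eqP; rewrite eqr_nat => /eqP.
have rs : all (root (p - q)) s by apply/allP => x _; rewrite rootE hornerD hornerN pq subrr.
by have := max_poly_roots h rs us; rewrite size_map size_iota ltnn.
Qed.

End RealPolynomials.

Section WeightsOfMultilinearMaps.
Context {R : realType}.
Implicit Types V W : wspace R.

(** Linear forms vanish at [0], so only constants contribute to [p 0]. Lower bounds on [c] are all
    extracted in this way or from depths of words. *)
Lemma wpoly_cst_ge0 V c (p : V -> R) : wpoly c p -> p 0 != 0 -> 0 <= c.
Proof.
elim=> {c p} [//|c p q _ IHp _ IHq|b c c' phi p [/scalar_lin[phi0 _ _ _ _] _] _ _ _].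
  have [->|p0 _] := eqVneq (p 0) 0; last exact: IHp.
  by rewrite add0r.
by rewrite phi0 mul0r eqxx.
Qed.

Lemma wpoly_lt0 V c (p : V -> R) v : neg_weight V -> wpoly c p -> c < 0 -> p v = 0.
Proof.
move=> nV /(wpoly_words (std_dot V))[[|x S] hS ->]; first by rewrite big_nil.
have [sx le_x] := hS x (mem_head _ _).
by rewrite ltNge (le_trans (word_depth_ge0 nV sx) le_x).
Qed.

(** Leibniz rule, with the derivative expressed as the coefficient of [t]. A factor [phi] with
    [phi u != 0] has weight at least [depth u], so trading it for the number [phi u] lowers the
    weight by that much. *)
Lemma wpoly_derivative V c p (u : V) : wpoly c p -> exists2 p' : V -> R,
  (u != 0 -> wpoly (c - depth u) p') &
  forall v, exists q : {poly R}, [/\ forall t, p (v + t *: u) = q.[t], q`_0 = p v & q`_1 = p' v].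
Proof.
elim=> {c p} [c k c0|c p q _ [p' hp' pE] _ [q' hq' qE]|b c c' phi p hphi hp [p' hp' pE] le_c].
- exists (fun _ => 0) => [_|v]; first exact: wpoly0.
  by exists k%:P; split=> [t||]; rewrite ?hornerC ?coefC.
- exists (fun v => p' v + q' v) => [u0|v].
    by apply: wpoly_add; [exact: hp'|exact: hq'].
  have [[r [rE r0 r1]] [s [sE s0 s1]]] := (pE v, qE v).
  exists (r + s); split=> [t||]; first by rewrite rE sE hornerD.
    by rewrite coefD r0 s0.
  by rewrite coefD r1 s1.
- exists (fun v => phi v * p' v + phi u * p v) => [u0|v].
    apply: wpoly_add.
      by apply: (wpoly_form hphi (hp' u0)); rewrite addrA lerD2r.
    have [->|phiu] := eqVneq (phi u) 0.
      by apply: wpoly_ext (wpoly0 _ _) => v; rewrite mul0r.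
    apply/wpoly_scale/(wpoly_le _ hp); rewrite lerBrDr (le_trans _ le_c) //.
    by rewrite addrC lerD2r; exact: form_le_depth phiu.
  have [_ phiD _ phiZ _] := scalar_lin hphi.1.
  have [r [rE r0 r1]] := pE v.
  exists (((phi v)%:P + (phi u) *: 'X) * r); split=> [t||].
  + by rewrite phiD phiZ rE hornerM hornerD hornerC hornerZ hornerX mulrC [phi u * t]mulrC mulrC.
  + by rewrite mulrDl coefD coefCM -scalerAl coefZ coefXM mulr0 addr0 r0.
  + by rewrite mulrDl coefD coefCM -scalerAl coefZ coefXM r0 r1.
Qed.

(** Multiplication by a form shifts degrees by one, so homogeneous components inherit the weight
    bound. *)
Lemma wpoly_homogeneous V c (p : V -> R) : wpoly c p -> exists2 h : nat -> V -> R,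
  (forall k, wpoly c (h k)) &
  forall v, exists q : {poly R}, (forall t, p (t *: v) = q.[t]) /\ forall k, q`_k = h k v.
Proof.
elim=> {c p} [c k c0|c p q _ [p' hp' pE] _ [q' hq' qE]|b c c' phi p hphi hp [p' hp' pE] le_c].
- exists (fun i _ => if i == 0 then k else 0) => [i|v]; first exact: wpoly_cst.
  by exists k%:P; split=> [t|i]; rewrite ?hornerC ?coefC.
- exists (fun i v => p' i v + q' i v) => [i|v]; first exact: wpoly_add.
  have [[r [rE rc]] [s [sE sc]]] := (pE v, qE v).
  by exists (r + s); split=> [t|i]; rewrite ?rE ?sE ?hornerD // coefD rc sc.
- exists (fun i v => if i is j.+1 then phi v * p' j v else 0) => [[|i]|v].
  + exact: wpoly0.
  + exact: wpoly_form hphi (hp' i) le_c.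
  have [r [rE rc]] := pE v; have [_ _ _ phiZ _] := scalar_lin hphi.1.
  exists ('X * (phi v *: r)); split=> [t|[|i]].
  + by rewrite phiZ rE hornerM hornerX hornerZ mulrA.
  + by rewrite coefXM.
  + by rewrite coefXM /= coefZ rc.
Qed.

Section Polarization.
Variables (V W : wspace R) (f : V -> W) (T : forall k, ('I_k -> V) -> W).
Hypothesis fT : polarization f T.

Lemma polarization_ray (phi : W -> R) v : scalar phi ->
  exists q : {poly R}, (forall t, phi (f (t *: v)) = q.[t]) /\
                       forall k, q`_k = phi (T (fun _ : 'I_k => v)).
Proof.
case: fT => mT [n [T0 fE]] /scalar_lin[phi0 _ _ phiZ phis].
exists (\poly_(k < n) phi (T (fun _ : 'I_k => v))); split=> [t|k]; last first.
  by rewrite coef_poly; case: ltnP => // /T0 ->; rewrite phi0.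
rewrite fE phis horner_poly; apply: eq_bigr => k _.
rewrite -!on_seq_diag -[nseq _ _]/([::] ++ nseq k (t *: v)) on_seq_homog ?phiZ 1?mulrC //.
by case: (mT k).
Qed.

Lemma wpoly_polarization_diag (phi : W -> R) c k : scalar phi -> wpoly c (phi \o f) ->
  wpoly c (fun v => phi (T (fun _ : 'I_k => v))).
Proof.
move=> phil /wpoly_homogeneous[h hh hE]; apply: wpoly_ext (hh k) => v.
have [q [qE <-]] := hE v; have [r [rE <-]] := polarization_ray v phil.
by suff -> : q = r by []; apply: poly_horner_inj => t; rewrite -qE -rE.
Qed.

(** Replacing one argument [v] by [u] is, up to the factor [m.+1], differentiating in direction [u];
    each replacement lowers the weight by [depth u]. *)
Lemma wpoly_polarization (phi : W -> R) c k (l : seq V) m :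
    scalar phi -> wpoly c (phi \o f) -> (size l + m = k)%N -> all (fun x => x != 0) l ->
  wpoly (c - word_depth l) (fun v => phi (on_seq (T (k := k)) (l ++ nseq m v))).
Proof.
move=> phil hf; rewrite /word_depth; elim: l m => [|u l IH] m.
  rewrite add0n => -> _; rewrite big_nil subr0.
  apply: wpoly_ext (wpoly_polarization_diag k phil hf) => v.
  by rewrite -on_seq_diag.
rewrite /= addSnnS => sz /andP[u0 l0]; rewrite big_cons opprD addrCA addrC.
have [p' /(_ u0) hp' pE] := wpoly_derivative u (IH _ sz l0).
case: fT => /(_ k)[mT sT] _.
apply: wpoly_ext (wpoly_scale (m.+1%:R^-1) hp') => v.
have [q [qE _ <-]] := pE v; have [r [rE _ r1]] := on_seq_derivative u v phil mT sT sz.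
have -> : q = r by apply: poly_horner_inj => t; rewrite -rE -qE.
rewrite r1 mulrA mulVf ?mul1r ?pnatr_eq0 //; congr phi.
apply: on_seq_perm => //; first by rewrite /= size_cat size_nseq -addnS.
by rewrite -[u :: l ++ _]cat1s -[u :: nseq _ _]cat1s perm_catCA.
Qed.

(** With all [k] arguments used as directions, the polynomial left over is the constant [phi (T v)];
    if it is nonzero, its weight bound must be nonnegative. Coordinate forms of an adapted basis
    then bound the weight of [T v]. *)
Lemma wt_polarization dl k : (forall b phi, form_le b phi -> wpoly (b + dl) (phi \o f)) ->
  (wt_multi (T (k := k)) <= dl%:E)%E.
Proof.
move=> hf; apply: ge_ereal_sup => _ [v v0 <-].
pose l := [seq v i | i <- enum 'I_k].
have -> : (\sum_(i < k) wt V (v i) = (- word_depth l)%:E)%E.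
  rewrite /word_depth big_map big_enum /= -sumrN -sumEFin; apply: eq_bigr => i _.
  by rewrite wt_depth.
rewrite -EFinN opprK; suff : (wt W (T v) <= (dl - word_depth l)%:E)%E.
  by rewrite EFinB leeBrDr.
pose d := std_dot W; apply: (wt_le_adapted (d := d)) => e es dv.
rewrite wt_depth ?(adapted_basis_neq0 es) // lee_fin.
have sz : (size l + 0 = k)%N by rewrite addn0 size_map size_enum_ord.
have l0 : all (fun x => x != 0) l by apply/allP => _ /mapP[i _ ->]; apply: v0.
have := wpoly_polarization (dot_scalar d e) (hf _ _ (form_le_dot es)) sz l0.
move=> /wpoly_cst_ge0; rewrite cats0 -on_seq_codom => /(_ dv) h.
lra.
Qed.

End Polarization.

(** Converse passage from multilinear maps to polynomials: the free arguments are expanded one by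
    one in an adapted basis, until only constants remain and the hypothesis on [T] shows that their
    weight bound is nonnegative. *)
Lemma wpoly_on_seq V W k (T : ('I_k -> V) -> W) dl b (phi : W -> R) l m :
    multilinear_map T -> (wt_multi T <= dl%:E)%E -> form_le b phi ->
    all (fun x => x != 0) l -> (size l + m = k)%N ->
  wpoly (b + dl - word_depth l) (fun v => phi (on_seq T (l ++ nseq m v))).
Proof.
move=> mT wT hphi; have [_ _ _ phiZ phis] := scalar_lin hphi.1.
elim: m l => [|m IH] l l0 sz.
  apply: (@wpoly_ext _ _ _ (fun _ => phi (on_seq T l))) => [v|]; first by rewrite cats0.
  have [->|phiT] := eqVneq (phi (on_seq T l)) 0; first exact: wpoly0.
  apply: wpoly_cst; have le_b := form_le_depth hphi phiT.
  have T0 : on_seq T l != 0.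
    by apply: contraNneq phiT => ->; case: (scalar_lin hphi.1) => ->.
  rewrite addn0 in sz.
  have v0 (i : 'I_k) : nth 0 l i != 0 by apply: (allP l0); rewrite mem_nth // sz.
  have : (wt W (on_seq T l) - \sum_(i < k) wt V (nth 0%R l i) <= dl%:E)%E.
    by apply: le_trans wT; apply: ereal_sup_ubound; exists (fun i => nth 0 l i).
  have -> : (\sum_(i < k) wt V (nth 0%R l i) = (- word_depth l)%:E)%E.
    rewrite /word_depth (big_nth 0) sz big_mkord -sumrN -sumEFin; apply: eq_bigr => i _.
    by rewrite wt_depth.
  rewrite (wt_depth T0) -EFinN (opprK (word_depth l)) -EFinD lee_fin => h; lra.
pose d := std_dot V.
have E v : phi (on_seq T (l ++ nseq m.+1 v)) =
    \sum_(e <- adapted_basis d) d e v * phi (on_seq T (rcons l e ++ nseq m v)).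
  rewrite /= [in X in X :: _](adapted_basis_sum d v) on_seq_sum ?size_nseq // phis.
  by apply: eq_bigr => e _; rewrite phiZ cat_rcons.
have -> : (fun v => phi (on_seq T (l ++ nseq m.+1 v))) = fun v =>
    \sum_(e <- adapted_basis d | e \in adapted_basis d)
       d e v * phi (on_seq T (rcons l e ++ nseq m v)).
  by apply/funext => v; rewrite E [LHS]big_seq.
apply: wpoly_sum => e es; have e0 := adapted_basis_neq0 es.
apply: (wpoly_form (form_le_dot es) (IH (rcons l e) _ _)).
- by rewrite all_rcons e0.
- by rewrite size_rcons addSnnS.
- by rewrite /word_depth big_rcons /=; lra.
Qed.

End WeightsOfMultilinearMaps.

(** * Subresonant maps *)

Section PolynomialMapAlgebra.
Context {R : realType}.
Implicit Types V W : vectType R.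

Lemma polynomial_map0 V W : polynomial_map (fun _ : V => 0 : W).
Proof.
exists (fun _ _ => 0); split.
  by move=> k; split=> [v i c x y|s v] //=; rewrite scaler0 addr0.
by exists 0%N; split=> // v; rewrite big_ord0.
Qed.

Lemma polarization_widen V W (f : V -> W) (T : forall k, ('I_k -> V) -> W) :
  polarization f T -> exists n, forall m, (n <= m)%N ->
    (forall k v, (m <= k)%N -> T k v = 0) /\ forall v, f v = \sum_(k < m) T k (fun=> v).
Proof.
move=> [_ [n [T0 fE]]]; exists n => m le_nm; split=> [k v le_mk|v].
  by apply: T0; exact: leq_trans le_mk.
rewrite fE -!(big_mkord xpredT (fun k => T k (fun=> v))) [RHS](big_cat_nat (leq0n n) le_nm) /=.
rewrite [X in _ + X]big_nat_cond [X in _ + X]big1 ?addr0 // => k.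
by rewrite andbT => /andP[/T0 ->].
Qed.

Lemma polynomial_mapD V W (f g : V -> W) : polynomial_map f -> polynomial_map g ->
  polynomial_map (fun v => f v + g v).
Proof.
move=> [T fT] [S gS]; exists (fun k v => T k v + S k v); split.
  move=> k; case: fT gS => /(_ k)[mT sT] _ [/(_ k)[mS sS] _].
  split=> [v i c x y|s v]; last by rewrite sT sS.
  by rewrite /= mT mS scalerDr addrACA.
have [n hn] := polarization_widen fT; have [m hm] := polarization_widen gS.
have [T0 fE] := hn _ (leq_maxl n m); have [S0 gE] := hm _ (leq_maxr n m).
exists (maxn n m); split=> [k v le_k|v]; first by rewrite T0 // S0 // addr0.
by rewrite fE gE -big_split.
Qed.

Lemma polynomial_map_sum V W (I : eqType) (r : seq I) (F : I -> V -> W) :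
  (forall i, i \in r -> polynomial_map (F i)) ->
  polynomial_map (fun v => \sum_(i <- r) F i v).
Proof.
elim: r => [|i r IH] h.
  by have -> : (fun v : V => \sum_(i <- [::]) F i v) = fun _ => 0;
    [apply/funext => v; rewrite big_nil|exact: polynomial_map0].
have -> : (fun v : V => \sum_(j <- i :: r) F j v) = fun v => F i v + \sum_(j <- r) F j v.
  by apply/funext => v; rewrite big_cons.
apply: polynomial_mapD; first by apply: h; rewrite mem_head.
by apply: IH => j jr; apply: h; rewrite inE jr orbT.
Qed.

(* The polarization of a product of linear forms is the average over all
   permutations of the factors. *)
Lemma polynomial_map_monomial V W (d : {dot V for idfun}) (w : seq V) (a : W) :
  polynomial_map (fun v => (\prod_(e <- w) d e v) *: a).
Proof.
pose P k (v : 'I_k -> V) : R := \sum_(s : 'S_k) \prod_(j < k) d (nth 0 w j) (v (s j)).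
pose T k (v : 'I_k -> V) : W := if k == size w then (k`!%:R^-1 * P k v) *: a else 0.
exists T; split=> [k|].
  rewrite /T; case: eqP => [_|]; last by split=> [v i c x y|] //=; rewrite scaler0 addr0.
  split=> [v i c x y|s v] /=; last first.
    congr ((_ * _) *: _); rewrite /P (reindex_inj (mulIg s^-1)%g) /=.
    by apply: eq_bigr => s' _; apply: eq_bigr => j _; rewrite permM permKV.
  rewrite scalerA -scalerDl; congr (_ *: _); rewrite /P mulrCA -mulrDr; congr (_ * _).
  rewrite mulr_sumr -big_split /=; apply: eq_bigr => s _.
  pose j0 := (s^-1 i)%g.
  have E z : \prod_(j < k) d (nth 0 w j) (@dfwith _ (fun=> V) v i z (s j)) =
      d (nth 0 w j0) z * \prod_(j < k | j != j0) d (nth 0 w j) (v (s j)).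
    rewrite (bigD1 j0) //= /j0 permKV dfwithin; congr (_ * _).
    apply: eq_bigr => j ji; rewrite dfwithout //; apply: contraNneq ji => ->.
    by rewrite permK.
  by rewrite !E dotDr dotZr mulrDl mulrA.
exists (size w).+1; split=> [k v lt_k|v]; first by rewrite /T gtn_eqF.
rewrite big_ord_recr /= [X in _ = X + _]big1 ?add0r => [|k _]; last by rewrite /T ltn_eqF.
rewrite /T eqxx; congr (_ *: _); rewrite /P sumr_const card_Sn (big_nth 0) big_mkord.
by rewrite -(mulr_natl (\prod_(_ < _) _)) mulKf // pnatr_eq0 -lt0n fact_gt0.
Qed.

End PolynomialMapAlgebra.

Section Classes.
Context {R : realType}.
Implicit Types V W U : wspace R.

Lemma polynomial_map_wpoly V (W : vectType R) (f : V -> W) :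
  (forall psi, scalar psi -> exists c, wpoly c (psi \o f)) -> polynomial_map f.
Proof.
move=> hf; pose X := vbasis {: W}; pose d := std_dot V.
have -> : f = fun v => \sum_(i <- enum 'I_(\dim {: W})) coord X i (f v) *: X`_i.
  by apply/funext => v; rewrite big_enum /= {1}(coord_vbasis (memvf (f v))).
apply: polynomial_map_sum => i _.
have [c /(wpoly_words d)[S _ SE]] := hf _ (scalar_coord X i).
have -> : (fun v => coord X i (f v) *: X`_i) =
    fun v => \sum_(x <- S) monomial d x.2 v *: (x.1 *: X`_i).
  apply/funext => v; rewrite -[coord _ _ _]/((coord X i \o f) v) SE scaler_suml.
  by apply: eq_bigr => x _; rewrite scalerA mulrC.
by apply: polynomial_map_sum => x _; exact: polynomial_map_monomial.
Qed.

(** Depths may have either sign here, whence the absolute values in the witness. *)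
Lemma depth_ub V : exists2 m : R, 0 <= m & forall v : V, v != 0 -> depth v <= m.
Proof.
pose d := std_dot V; exists (\sum_(e <- adapted_basis d) `|depth e|) => [|v v0].
  exact: sumr_ge0.
have [e es ev] : exists2 e, e \in adapted_basis d & d e v != 0.
  apply: contrapT => h; case/eqP: v0; rewrite (adapted_basis_sum d v) big_seq big1 // => e es.
  by have [->|ev] := eqVneq (d e v) 0; [rewrite scale0r|case: h; exists e].
apply: le_trans (form_le_depth (form_le_dot es) ev) _; apply: le_trans (ler_norm _) _.
by rewrite (big_rem e es) /= lerDl sumr_ge0.
Qed.

Lemma form_le_exists V (phi : V -> R) : scalar phi -> exists b, form_le b phi.
Proof.
move=> phil; have [m _ hm] := depth_ub V; exists m; apply: form_leP => // v.
move=> phiv; apply: hm; apply: contraNneq phiv => ->.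
by case: (scalar_lin phil) => ->.
Qed.

(** A finite family of margins has a common one. Applied to an adapted basis, this turns strictness
    form by form into the single negative bound that the weight of a map requires. *)
Lemma uniform_gt0 (T : eqType) (s : seq T) (P : T -> R -> Prop) :
    (forall x a b, 0 < a -> a <= b -> P x b -> P x a) ->
    (forall x, x \in s -> exists2 a, 0 < a & P x a) ->
  exists2 a, 0 < a & forall x, x \in s -> P x a.
Proof.
move=> Ple; elim: s => [|x s IH] h; first by exists 1.
have [a a0 ha] : exists2 a, 0 < a & P x a by apply: h; rewrite mem_head.
have [y ys|b b0 hb] := IH; first by apply: h; rewrite inE ys orbT.
have m0 : 0 < Num.min a b by rewrite lt_min a0.
exists (Num.min a b) => // y; rewrite inE => /predU1P[->|/hb hy].
  by apply: Ple m0 _ ha; rewrite ge_min lexx.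
by apply: Ple m0 _ hy; rewrite ge_min lexx orbT.
Qed.

Lemma depth_lb V : neg_weight V ->
  exists2 m : R, 0 < m & forall v : V, v != 0 -> m <= depth v.
Proof.
move=> nV; pose d := std_dot V.
have [|e es|m m0 hm] := @uniform_gt0 _ (adapted_basis d) (fun e m => m <= depth e).
- by move=> e a b _ /le_trans; apply.
- by exists (depth e) => //; apply/depth_gt0/adapted_basis_neq0/es.
exists m => // v v0.
suff : (wt V v <= (- m)%:E)%E by rewrite wt_depth // lee_fin lerN2.
apply: (wt_le_adapted (d := d)) => e es _.
by rewrite wt_depth ?(adapted_basis_neq0 es) // lee_fin lerN2 hm.
Qed.

Lemma Dtilde_polarization V W (f : V -> W) : polynomial_map f -> polarization f (Dtilde f).
Proof. by rewrite /Dtilde => h; case: pselect => // h'; exact: projT2 (cid h'). Qed.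

(** The dictionary between weights of maps and pullbacks of forms. The shift [dl] lets it serve both
    subresonant maps ([dl = 0]) and strictly subresonant ones ([dl < 0]). *)
Lemma wt_polyP V W (f : V -> W) dl :
  (polynomial_map f /\ (wt_poly f <= dl%:E)%E) <->
  forall b phi, form_le b phi -> wpoly (b + dl) (phi \o f).
Proof.
split=> [[pf hf] b phi hphi|h].
  have [mT [n [T0 fE]]] := Dtilde_polarization pf.
  have hT k : (wt_multi (Dtilde f (k := k)) <= dl%:E)%E.
    by apply: le_trans hf; apply: ereal_sup_ubound; exists k.
  have [_ _ _ _ phis] := scalar_lin hphi.1.
  have E v : \sum_(k < n) phi (on_seq (Dtilde f (k := k)) ([::] ++ nseq k v)) = (phi \o f) v.
    by rewrite /= fE phis; apply: eq_bigr => k _; rewrite on_seq_diag.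
  apply: wpoly_ext E _; apply: wpoly_sum => k _.
  have := wpoly_on_seq (mT k).1 (hT k) hphi (isT : all (fun x => x != 0) [::]) (add0n k).
  by rewrite /word_depth big_nil subr0.
have pf : polynomial_map f.
  apply: polynomial_map_wpoly => psi /form_le_exists[b hpsi].
  by exists (b + dl); exact: h.
split=> //; apply: ge_ereal_sup => _ [k _ <-].
by apply: (wt_polarization (Dtilde_polarization pf)); exact: h.
Qed.

Lemma PSRP V W (f : V -> W) : PSR V W f <-> sr_map f.
Proof.
split=> [/wt_polyP h b phi hphi|h]; first by have := h b phi hphi; rewrite addr0.
by apply/wt_polyP => b phi hphi; rewrite addr0; exact: h.
Qed.

Lemma lt0_real_ub (x : \bar R) : (x < 0)%E -> exists2 dl : R, 0 < dl & (x <= (- dl)%:E)%E.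
Proof.
case: x => [r| |] // h; last by exists 1 => //; rewrite leNye.
by exists (- r); rewrite ?opprK // oppr_gt0 -lte_fin.
Qed.

(** The margin may depend on [p]; [strict_uniform] makes it common to all forms. *)
Definition strict V (b : R) (p : V -> R) := exists2 dl, 0 < dl & wpoly (b - dl) p.

Lemma strictD V b (p q : V -> R) : strict b p -> strict b q -> strict b (fun v => p v + q v).
Proof.
move=> [dl dl0 hp] [dl' dl0' hq]; exists (Num.min dl dl'); first by rewrite lt_min dl0.
apply: wpoly_add.
  by apply: wpoly_le hp; rewrite lerD2l lerN2 ge_min lexx.
by apply: wpoly_le hq; rewrite lerD2l lerN2 ge_min lexx orbT.
Qed.

(** Conditions on pullbacks of forms need only be checked on coordinate forms, for any class [X]
    that is linear and monotone in the weight. *)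
Lemma wmap_adapted V W (X : R -> (V -> R) -> Prop) (d : {dot W for idfun}) (f : V -> W) :
    (forall b, X b (fun _ => 0)) ->
    (forall b p q, X b p -> X b q -> X b (fun v => p v + q v)) ->
    (forall b k p, X b p -> X b (fun v => k * p v)) ->
    (forall b c p, b <= c -> X b p -> X c p) ->
    (forall e, e \in adapted_basis d -> X (depth e) (d e \o f)) ->
  forall b phi, form_le b phi -> X b (phi \o f).
Proof.
move=> X0 XD XZ Xle h b phi hphi.
have -> : phi \o f = fun v => \sum_(e <- adapted_basis d) phi e * (d e \o f) v.
  apply/funext => v; rewrite /= (scalar_adapted_basis d _ hphi.1).
  by apply: eq_bigr => e _; rewrite mulrC.
have : {subset adapted_basis d <= adapted_basis d} by [].
elim: {1 3}(adapted_basis d) => [|e s IH] hs.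
  by have -> : (fun v => \sum_(e <- [::]) phi e * (d e \o f) v) = fun _ => 0
    by apply/funext => v; rewrite big_nil.
have -> : (fun v => \sum_(e <- e :: s) phi e * (d e \o f) v) =
    fun v => phi e * (d e \o f) v + \sum_(e <- s) phi e * (d e \o f) v.
  by apply/funext => v; rewrite big_cons.
apply: XD; last by apply: IH => x xs; apply: hs; rewrite inE xs orbT.
(* When [phi e = 0] the depth of [e] may exceed [b], so monotonicity would not apply. *)
have [->|phie] := eqVneq (phi e) 0.
  by have -> : (fun v => 0 * (d e \o f) v) = fun _ => 0
    by apply/funext => v; rewrite mul0r.
apply/XZ/(Xle _ _ _ (form_le_depth hphi phie))/h/hs/mem_head.
Qed.

Lemma strict_uniform V W (f : V -> W) :
    (forall b phi, form_le b phi -> strict b (phi \o f)) ->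
  exists2 dl, 0 < dl & forall b phi, form_le b phi -> wpoly (b - dl) (phi \o f).
Proof.
move=> h; pose d := std_dot W.
have [|e es|dl dl0 hdl] := @uniform_gt0 _ (adapted_basis d)
    (fun e dl => wpoly (depth e - dl) (d e \o f)).
- by move=> e a b _ ab; apply: wpoly_le; rewrite lerD2l lerN2.
- by have [dl dl0 hp] := h _ _ (form_le_dot es); exists dl.
exists dl => //; apply: (wmap_adapted (X := fun b p => wpoly (b - dl) p)) hdl.
- by move=> b; exact: wpoly0.
- by move=> b p q; exact: wpoly_add.
- by move=> b k p; exact: wpoly_scale.
- by move=> b c p bc; apply: wpoly_le; rewrite lerD2r.
Qed.

Lemma PSSRP V W (f : V -> W) :
  PSSR V W f <-> forall b phi, form_le b phi -> strict b (phi \o f).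
Proof.
split=> [[pf /lt0_real_ub[dl dl0 hf]] b phi hphi|/strict_uniform[dl dl0 h]].
  by exists dl => //; apply: (iffLR (wt_polyP f (- dl))).
have [|pf hf] := iffRL (wt_polyP f (- dl)); first exact: h.
by split=> //; apply: (le_lt_trans hf); rewrite lte_fin oppr_lt0.
Qed.

(* [star b] is the part of [wpoly b] without linear terms of weight exactly [b]. *)
Inductive star V (b : R) : (V -> R) -> Prop :=
| star0 : star b (fun _ => 0)
| star_add p q : star b p -> star b q -> star b (fun v => p v + q v)
| star_mul c c' p q : wpoly c p -> wpoly c' q -> c < b -> c' < b -> c + c' <= b ->
    star b (fun v => p v * q v).

Lemma star_ext V b (p q : V -> R) : (forall v, p v = q v) -> star b p -> star b q.
Proof. by move=> /funext ->. Qed.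

(** The second factor is the constant [1], whose weight [0] is below [b]. *)
Lemma star_lt V b c (p : V -> R) : 0 < b -> c < b -> wpoly c p -> star b p.
Proof.
move=> b0 cb hp; apply: star_ext (star_mul hp (wpoly_cst V 1 (lexx 0)) cb b0 _) => [v|].
  by rewrite mulr1.
by rewrite addr0 ltW.
Qed.

Lemma star_scale V b k (p : V -> R) : star b p -> star b (fun v => k * p v).
Proof.
elim=> {p} [|p q _ hp _ hq|c c' p q hp hq cb c'b le_b].
- by apply: star_ext (star0 V b) => v; rewrite mulr0.
- by apply: star_ext (star_add hp hq) => v; rewrite mulrDr.
- by apply: star_ext (star_mul (wpoly_scale k hp) hq cb c'b le_b) => v; rewrite mulrA.
Qed.

Lemma star_sum V b (I : Type) (r : seq I) (P : pred I) (F : I -> V -> R) :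
  (forall i, P i -> star b (F i)) -> star b (fun v => \sum_(i <- r | P i) F i v).
Proof.
move=> hF; elim: r => [|i r IH].
  by apply: star_ext (star0 V b) => v; rewrite big_nil.
case Pi: (P i); last by apply: star_ext IH => v; rewrite big_cons Pi.
by apply: star_ext (star_add (hF i Pi) IH) => v; rewrite big_cons Pi.
Qed.

Lemma star_wpoly V b (p : V -> R) : star b p -> wpoly b p.
Proof.
elim=> {p} [|p q _ hp _ hq|c c' p q hp hq _ _ le_b]; first exact: wpoly0.
- exact: wpoly_add.
- exact: wpoly_mul hp hq le_b.
Qed.

Lemma star_comp V W (f : V -> W) b p : sr_map f -> star b p -> star b (p \o f).
Proof.
move=> hf; elim=> {p} [|p q _ hp _ hq|c c' p q hp hq cb c'b le_b]; first exact: star0.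
- exact: star_add.
- exact: star_mul (wpoly_comp hf hp) (wpoly_comp hf hq) cb c'b le_b.
Qed.

Lemma wpoly_linear_coef V c (p : V -> R) v : wpoly c p -> v != 0 ->
  exists q : {poly R}, (forall t, p (t *: v) = q.[t]) /\ (q`_1 != 0 -> depth v <= c).
Proof.
move=> hp v0; have [p' /(_ v0) hp' pE] := wpoly_derivative v hp.
have [q [qE _ q1]] := pE 0; exists q; split=> [t|]; first by rewrite -qE add0r.
by rewrite q1 => /(wpoly_cst_ge0 hp'); rewrite subr_ge0.
Qed.

(** The linear coefficient of a product combines a linear coefficient of one factor with the
    constant of the other, so it sees only directions of depth at most [Num.max c c'], which is
    below [b]. *)
Lemma star_linear_coef V b (p : V -> R) : star b p -> exists2 c, c < b &
  forall v, v != 0 -> exists q : {poly R},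
    (forall t, p (t *: v) = q.[t]) /\ (q`_1 != 0 -> depth v <= c).
Proof.
elim=> {p} [|p q _ [c cb hp] _ [c' cb' hq]|c c' p q hp hq cb c'b _].
- exists (b - 1) => [|v _]; first by rewrite ltrBlDr ltrDl.
  by exists 0; split=> [t|]; rewrite ?horner0 // coef0 eqxx.
- exists (Num.max c c') => [|v v0]; first by rewrite gt_max cb.
  have [[r [rE r1]] [s [sE s1]]] := (hp v v0, hq v v0).
  exists (r + s); split=> [t|]; first by rewrite hornerD rE sE.
  rewrite coefD le_max; have [->|/r1 -> //] := eqVneq r`_1 0.
  by rewrite add0r => /s1 ->; rewrite orbT.
- exists (Num.max c c') => [|v v0]; first by rewrite gt_max cb.
  have [[r [rE r1]] [s [sE s1]]] := (wpoly_linear_coef hp v0, wpoly_linear_coef hq v0).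
  exists (r * s); split=> [t|]; first by rewrite hornerM rE sE.
  rewrite coefM !big_ord_recl big_ord0 /= addr0 le_max.
  have [->|/r1 -> //] := eqVneq r`_1 0; rewrite mul0r addr0.
  have [->|/s1 ->] := eqVneq s`_1 0; first by rewrite mulr0 eqxx.
  by rewrite orbT.
Qed.

Section LinearPart.
Variables (V W : wspace R) (f : V -> W).
Hypothesis pf : polynomial_map f.

Lemma D0_linear : linear (D0 f).
Proof.
move=> c u v; have [mT _] := Dtilde_polarization pf; have [/(_ _ ord0) h _] := mT 1%N.
have E z : D0 f z = Dtilde f (@dfwith _ (fun=> V) (fun _ : 'I_1 => 0) ord0 z).
  by congr Dtilde; apply/funext => i; rewrite (ord1 i) dfwithin.
by rewrite !E h.
Qed.

Lemma D0_ray (phi : W -> R) v : scalar phi ->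
  exists q : {poly R}, (forall t, phi (f (t *: v)) = q.[t]) /\ q`_1 = phi (D0 f v).
Proof.
by move=> /(polarization_ray (Dtilde_polarization pf) v)[q [qE qc]]; exists q.
Qed.

Lemma D0_unique v w : (forall phi : W -> R, scalar phi ->
    exists q : {poly R}, (forall t, phi (f (t *: v)) = q.[t]) /\ q`_1 = phi w) -> D0 f v = w.
Proof.
move=> h; apply: scalar_separates => phi phil.
have [[q [qE <-]] [r [rE <-]]] := (D0_ray v phil, h phi phil).
by suff -> : q = r by []; apply: poly_horner_inj => t; rewrite -qE -rE.
Qed.

End LinearPart.

(** The constant term has weight [0], below [b]. From a term of degree at least two, two coordinate
    factors are pulled out, and positivity of depths makes both resulting factors lighter than
    [b]. *)
Lemma PSR_linear_part V W (f : V -> W) b phi : neg_weight V -> neg_weight W ->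
  PSR V W f -> form_le b phi -> star b (fun v => phi (f v) - phi (D0 f v)).
Proof.
move=> nV nW [pf hf] hphi; have [phi0 _ _ _ phis] := scalar_lin hphi.1.
have [b0|b0] := leP b 0.
  by apply: star_ext (star0 V b) => v; rewrite !(form_le_eq0 nW b0 hphi) subr0.
have hT k : (wt_multi (Dtilde f (k := k)) <= 0%:E)%E.
  by apply: le_trans hf; apply: ereal_sup_ubound; exists k.
have mT k : multilinear_map (Dtilde f (k := k)) by case: (Dtilde_polarization pf) => /(_ k)[].
have [n hn] := polarization_widen (Dtilde_polarization pf).
(* At least two terms, so that the index [1] of the linear part exists whatever [n] is. *)
have [T0 fE] := hn n.+2 (leqW (leqnSn n)).
pose F k v := phi (on_seq (Dtilde f (k := k)) (nseq k v)).
have E v : \sum_(k < n.+2 | k != 1 :> nat) F k v = phi (f v) - phi (D0 f v).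
  rewrite fE phis [X in _ = X - _](bigD1 (Ordinal (isT : (1 < n.+2)%N))) //= addrAC subrr add0r.
  by apply: eq_bigr => k _; rewrite /F on_seq_diag.
have hF k l : (size l <= k)%N -> all (fun x => x != 0) l ->
    wpoly (b - word_depth l) (fun v => phi (on_seq (Dtilde f (k := k)) (l ++ nseq (k - size l) v))).
  move=> le_k l0; have := wpoly_on_seq (mT k) (hT k) hphi l0 (subnKC le_k).
  by rewrite addr0.
apply: star_ext E _; apply: star_sum => -[[|[|k]] /= lt_k] // _.
  exact: (star_lt b0 b0 (wpoly_cst V (phi (on_seq (Dtilde f (k := 0)) [::])) (lexx 0))).
pose d := std_dot V; pose s := adapted_basis d.
have E v : \sum_(e <- s | e \in s) \sum_(e' <- s | e' \in s)
    d e v * (d e' v * phi (on_seq (Dtilde f (k := k.+2)) (e :: e' :: nseq k v))) = F k.+2 v.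
  rewrite /F /= -[v :: v :: _]/([::] ++ v :: (v :: nseq k v)).
  rewrite [in X in X :: _ :: _](adapted_basis_sum d v) on_seq_sum //=; last by rewrite size_nseq.
  rewrite phis [RHS]big_seq; apply: eq_bigr => e es.
  rewrite -[e :: v :: _]/([:: e] ++ v :: nseq k v).
  rewrite [in X in _ ++ X :: _](adapted_basis_sum d v) on_seq_sum ?size_nseq //=.
  have [_ _ _ phiZ _] := scalar_lin hphi.1.
  rewrite phiZ phis mulr_sumr [RHS]big_seq; apply: eq_bigr => e' es'.
  by rewrite phiZ.
apply: star_ext E _; apply: star_sum => e es; apply: star_sum => e' es'.
have e0 := adapted_basis_neq0 es; have e0' := adapted_basis_neq0 es'.
have := depth_gt0 nV e0; have := depth_gt0 nV e0' => dp' dp.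
have := @hF k.+2 [:: e; e'] isT; rewrite /= e0 e0' subn2 /= /word_depth !big_cons big_nil addr0.
(* If both depths fit into [b], the factors have weights [depth e] and [b - depth e]. Otherwise the
   polynomial in [hw] has negative weight and vanishes. *)
move=> /(_ isT) hw; have [le_b|lt_b] := leP 0 (b - (depth e + depth e')).
  clear hT hf hF; apply: (star_mul (c := depth e) (c' := b - depth e)); try lra.
  - exact/wpoly_lin/form_le_dot.
  - by apply: (wpoly_form (form_le_dot es') hw); lra.
apply: star_ext (star0 V b) => v.
by rewrite (wpoly_lt0 v nV hw lt_b) !mulr0.
Qed.

Lemma PstarP V W (f : V -> W) : neg_weight V -> neg_weight W ->
  Pstar V W f <-> forall b phi, form_le b phi -> star b (phi \o f).
Proof.
move=> nV nW; split=> [[hf /lt0_real_ub[dl dl0 h1]] b phi hphi|h].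
  have E v : phi (f v) - phi (D0 f v) + phi (D0 f v) = (phi \o f) v by rewrite subrK.
  apply: star_ext E _; apply: star_add; first exact: PSR_linear_part.
  have [b0|b0] := leP b 0.
    by apply: star_ext (star0 V b) => v; rewrite (form_le_eq0 nW b0 hphi).
  apply: (star_lt (c := b - dl) b0); first lra.
  have [mT _] := Dtilde_polarization hf.1.
  have := wpoly_on_seq (mT 1%N).1 h1 hphi (isT : all (fun x => x != 0) [::]) (add0n 1%N).
  rewrite /word_depth big_nil subr0; apply: wpoly_ext => v.
  by rewrite -[[::] ++ _]/(nseq 1 v) on_seq_diag.
have hf : PSR V W f by apply/PSRP => b phi hphi; apply/star_wpoly/h.
split=> //; pose d := std_dot W.
(* Each coordinate [e] has a margin [depth e - c], with [c] from [star_linear_coef]; the minimum of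
   these bounds the weight of [D0 f]. *)
have [|e es|dl dl0 hdl] := @uniform_gt0 _ (adapted_basis d)
    (fun e dl => forall v, v != 0 -> d e (D0 f v) != 0 -> depth v <= depth e - dl).
- by move=> e a b _ ab hb v v0 /(hb v v0)/le_trans; apply; rewrite lerD2l lerN2.
- have [c cb hc] := star_linear_coef (h _ _ (form_le_dot es)).
  exists (depth e - c) => [|v v0]; first by rewrite subr_gt0.
  have [q [qE q1]] := hc v v0; have [r [rE <-]] := D0_ray hf.1 v (dot_scalar d e).
  have <- : q = r by apply: poly_horner_inj => t; rewrite -qE -rE.
  by move=> /q1; rewrite opprB addrCA subrr addr0.
apply: (@le_lt_trans _ _ (- dl)%:E); last by rewrite lte_fin oppr_lt0.
apply: ge_ereal_sup => _ [v v0 <-].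
have vE : v = fun=> v ord0 by apply/funext => i; rewrite (ord1 i).
rewrite big_ord_recl big_ord0 adde0 (wt_depth (v0 ord0)) -EFinN (opprK (depth _)).
rewrite -leeBrDr // -EFinB; apply: (wt_le_adapted (d := d)) => e es dv.
rewrite wt_depth ?(adapted_basis_neq0 es) // lee_fin.
rewrite {1}vE in dv; move: (hdl e es (v ord0) (v0 ord0) dv) => h'; clear hf; lra.
Qed.

(** Chain rule: along a direction killed by [D0 f], every polynomial in [f] has zero linear
    coefficient. *)
Lemma D0_kernel V W (f : V -> W) v c p : polynomial_map f -> D0 f v = 0 -> wpoly c p ->
  exists q : {poly R}, (forall t, p (f (t *: v)) = q.[t]) /\ q`_1 = 0.
Proof.
move=> pf Dv; elim=> {c p} [c k _|c p q _ [r [rE r1]] _ [s [sE s1]]|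
    b c c' phi p hphi _ [r [rE r1]] _].
- by exists k%:P; split=> [t|]; rewrite ?hornerC ?coefC.
- by exists (r + s); split=> [t|]; rewrite ?hornerD ?rE ?sE // coefD r1 s1 addr0.
have [s [sE s1]] := D0_ray pf v hphi.1.
exists (s * r); split=> [t|]; first by rewrite hornerM rE sE.
rewrite coefM !big_ord_recl big_ord0 /= addr0 r1 s1 Dv.
by case: (scalar_lin hphi.1) => -> _ _ _ _; rewrite mulr0 mul0r addr0.
Qed.

(** If [D0 f v = 0], then [phi (g (f (t *: v))) = t * phi v] has zero linear coefficient by the
    chain rule, so every [phi v] vanishes. *)
Lemma D0_inj_of_left_inverse V W (f : V -> W) (g : W -> V) : polynomial_map f ->
  (forall phi, scalar phi -> exists c, wpoly c (phi \o g)) -> cancel f g ->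
  injective (D0 f).
Proof.
move=> pf hg fK; suff D0_eq0 v : D0 f v = 0 -> v = 0.
  move=> u v uv; apply/eqP; rewrite -subr_eq0; apply/eqP/D0_eq0.
  have := D0_linear pf (-1) v u; rewrite uv !scaleN1r addNr => <-; congr D0.
  by rewrite addrC.
move=> Dv; apply: scalar_separates => phi phil.
have [c hc] := hg phi phil; have [q [qE q1]] := D0_kernel pf Dv hc.
have [phi0 _ _ phiZ _] := scalar_lin phil.
have : q = phi v *: 'X.
  by apply: poly_horner_inj => t; rewrite -qE /= fK phiZ hornerZ hornerX mulrC.
by move=> /(congr1 (fun q : {poly R} => q`_1)); rewrite q1 coefZ coefX mulr1 phi0.
Qed.

End Classes.

(** * Inverses of subresonant maps *)

Section Inverse.
Context {R : realType}.
Implicit Types V W U : wspace R.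

Lemma D0_wt_le V W (f : V -> W) v : PSR V W f -> (wt W (D0 f v) <= wt V v)%E.
Proof.
move=> [pf hf]; have [->|v0] := eqVneq v 0.
  have := D0_linear pf (-1) 0 0; rewrite scaler0 addr0 scaleN1r addNr => ->.
  by rewrite !wt0.
have hT : (wt_multi (Dtilde f (k := 1)) <= 0)%E.
  by apply: le_trans hf; apply: ereal_sup_ubound; exists 1%N.
have : (wt W (D0 f v) - \sum_(i < 1) wt V v <= 0)%E.
  by apply: le_trans hT; apply: ereal_sup_ubound; exists (fun=> v).
by rewrite big_ord_recl big_ord0 adde0 (wt_depth v0) leeBlDr // add0e.
Qed.

Lemma PSR_pullback_surj V (f : V -> V) : neg_weight V -> PSR V V f -> bijective (D0 f) ->
  forall c p, wpoly c p -> exists2 q, wpoly c q & forall v, q (f v) = p v.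
Proof.
move=> nV hf bf; have [A AE] := linear_lfun (D0_linear hf.1).
have kA : lker A == 0%VS by apply/lker0P => u v; rewrite !AE; exact: bij_inj.
(* [A] maps each sublevel space into itself, hence onto it by injectivity and equality of
   dimensions; the inverse therefore does not raise weights. *)
have wtA v : (wt V ((A^-1)%VF v) <= wt V v)%E.
  pose lam := wt V v; have sub : (A @: wt_le (wt V) lam <= wt_le (wt V) lam)%VS.
    apply/subvP => _ /memv_imgP[u /wt_leP hu ->]; apply/wt_leP.
    by rewrite AE; apply: le_trans (D0_wt_le _ hf) hu.
  have : v \in (A @: wt_le (wt V) lam)%VS.
    have /eqP -> : (A @: wt_le (wt V) lam)%VS == wt_le (wt V) lam.
      by rewrite eqEdim sub (@limg_dim_eq _ _ _ A) ?leqnn // (eqP kA) capv0.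
    exact/wt_leP.
  by move=> /memv_imgP[u /wt_leP hu vE]; rewrite {1}vE lker0_lfunK.
apply: (wpoly_algebra_ind (Q := fun c p => exists2 q, wpoly c q & forall v, q (f v) = p v) nV).
- by move=> c; exists (fun _ => 0) => //; exact: wpoly0.
- by move=> c k c0; exists (fun _ => k) => //; exact: wpoly_cst.
- move=> c p q [p' hp pE] [q' hq qE]; exists (fun v => p' v + q' v); first exact: wpoly_add.
  by move=> v; rewrite pE qE.
- move=> b c e p q [p' hp pE] [q' hq qE] le_e; exists (fun v => p' v * q' v).
    exact: wpoly_mul hp hq le_e.
  by move=> v; rewrite pE qE.
move=> b phi hphi IH.
have Qstar p : star b p -> exists2 q, wpoly b q & forall v, q (f v) = p v.
  elim=> {p} [|p q _ [p' hp pE] _ [q' hq qE]|c c' p q hp hq cb c'b le_b].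
  - by exists (fun _ => 0) => //; exact: wpoly0.
  - exists (fun v => p' v + q' v); first exact: wpoly_add.
    by move=> v; rewrite pE qE.
  - have [p' hp' pE] := IH c p cb hp; have [q' hq' qE] := IH c' q c'b hq.
    exists (fun v => p' v * q' v); first exact: wpoly_mul hp' hq' le_b.
    by move=> v; rewrite pE qE.
(* The pullback by [f] of this form is [phi] plus an element of [star b], and the latter is a
   pullback by the induction hypothesis. *)
have hpsi : form_le b (phi \o (A^-1)%VF).
  split=> [c u v|v /hphi.2/le_trans]; last exact.
  by rewrite /= linearP hphi.1.
have [q hq qE] := Qstar _ (PSR_linear_part nV nV hf hpsi).
exists (fun v => (phi \o (A^-1)%VF) v - q v); first by apply: wpoly_sub hq; apply: wpoly_lin.
by move=> v; rewrite qE subKr /= -AE lker0_lfunK.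
Qed.

Lemma PSR_left_inverse V (f : V -> V) : neg_weight V -> PSR V V f -> bijective (D0 f) ->
  exists2 g, sr_map g & cancel f g.
Proof.
move=> nV hf bf; pose d := std_dot V.
have : forall e, exists q : V -> R, e \in adapted_basis d ->
    wpoly (depth e) q /\ forall v, q (f v) = d e v.
  move=> e; case es: (e \in adapted_basis d); last by exists (fun _ => 0).
  have [q hq qE] := PSR_pullback_surj nV hf bf (wpoly_lin (form_le_dot es)).
  by exists q.
(* The coordinates of the inverse are preimages of the coordinate forms under the pullback by
   [f]. *)
move=> /choice[q qP]; pose g v := \sum_(e <- adapted_basis d) q e v *: e.
have gE e v : e \in adapted_basis d -> d e (g v) = q e v.
  move=> es; rewrite /g; have [_ _ _ _ ->] := dot_linr d e.
  rewrite (bigD1_seq e) ?adapted_basis_uniq //= dotZr adapted_basis_ortho // eqxx mulr1.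
  rewrite big_seq_cond big1 ?addr0 // => e' /andP[es' ne].
  by rewrite dotZr adapted_basis_ortho // eq_sym (negbTE ne) mulr0.
exists g => [|v].
  apply: (wmap_adapted (d := d)).
  - exact: wpoly0.
  - exact: wpoly_add.
  - by move=> b k p; exact: wpoly_scale.
  - exact: wpoly_le.
  - move=> e es; have [hq _] := qP e es; apply: wpoly_ext hq => v /=.
    by rewrite gE.
rewrite [RHS](adapted_basis_sum d v) /g big_seq [RHS]big_seq; apply: eq_bigr => e es.
by have [_ ->] := qP e es.
Qed.

End Inverse.

(** * The linearized space *)

Section Words.
Context {R : realType}.
Implicit Types V W U : wspace R.

(* Both bounds are chosen as functions of the set of values only, so that they
   agree for compatible spaces. *)
Definition val_max (S : set (\bar R)) : R :=
  xget 0 [set m | 0 <= m /\ forall l, S l -> ((- m)%:E <= l)%E].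

Definition val_len (S : set (\bar R)) : nat :=
  xget 0%N [set n | forall l, S l -> val_max S < n%:R * (- fine l)].

Lemma wt_values_neq0 V (v : V) : v != 0 -> wt_values (wt V) (wt V v).
Proof. by move=> v0; exists v. Qed.

Definition max_depth V : R := val_max (wt_values (wt V)).

Definition max_length V : nat := val_len (wt_values (wt V)).

Lemma max_depthP V : 0 <= max_depth V /\ forall v : V, v != 0 -> depth v <= max_depth V.
Proof.
have [m m0 hm] := depth_ub V.
have [] := @xgetPex _ 0 [set m : R | 0 <= m /\
    forall l, wt_values (wt V) l -> ((- m)%:E <= l)%E].
  exists m; split=> // _ [v v0 <-]; rewrite wt_depth // lee_fin lerN2; exact: hm.
move=> h0 h; split=> // v v0.
by have := h _ (wt_values_neq0 v0); rewrite wt_depth // lee_fin lerN2.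
Qed.

Lemma max_lengthP V (v : V) : neg_weight V -> v != 0 ->
  max_depth V < (max_length V)%:R * depth v.
Proof.
move=> nV v0; have [m m0 hm] := depth_lb nV.
have := @xgetPex _ 0%N [set n : nat | forall l, wt_values (wt V) l ->
    max_depth V < n%:R * (- fine l)] _ _ (wt_values_neq0 v0); apply.
exists (Num.bound (max_depth V / m)) => _ [u u0 <-].
apply: (@lt_le_trans _ _ ((Num.bound (max_depth V / m))%:R * m)).
  rewrite -ltr_pdivrMr //; apply: archi_boundP.
  by apply: divr_ge0; [case: (max_depthP V)|exact: ltW].
by rewrite ler_wpM2l // hm.
Qed.

Lemma form_le_max_depth V (phi : V -> R) : scalar phi -> form_le (max_depth V) phi.
Proof.
move=> phil; apply: form_leP => // v phiv; apply: (max_depthP V).2.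
by apply: contraNneq phiv => ->; case: (scalar_lin phil) => ->.
Qed.

(** [n] bounds the length and serves as fuel. Permuted words are listed separately, so that sums
    over words unfold one letter at a time. *)
Fixpoint words V (s : seq V) (n : nat) (b : R) : seq (seq V) :=
  if n is n'.+1 then
    [::] :: flatten [seq [seq e :: w | w <- words s n' (b - depth e)]
                    | e <- [seq e <- s | depth e <= b]]
  else [:: [::]].

Lemma words_sum V (s : seq V) n b (F : seq V -> R) :
  \sum_(w <- words s n.+1 b) F w =
  F [::] + \sum_(e <- s | depth e <= b) \sum_(w <- words s n (b - depth e)) F (e :: w).
Proof.
rewrite /= big_cons big_flatten /= big_map big_filter; congr (_ + _).
by apply: eq_bigr => e _; rewrite big_map.
Qed.

Lemma words_sub V (s : seq V) n b w : 0 <= b -> w \in words s n b ->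
  {subset w <= s} /\ word_depth w <= b.
Proof.
elim: n b w => [|n IH] b w b0 /=; rewrite inE.
  by move=> /eqP ->; split=> //; rewrite /word_depth big_nil.
move=> /predU1P[->|]; first by split=> //; rewrite /word_depth big_nil.
move=> /flatten_mapP[e]; rewrite mem_filter => /andP[le_e es] /mapP[w' hw' ->].
have [|sw le_w] := IH _ _ _ hw'; first by rewrite subr_ge0.
split; first by move=> x; rewrite inE => /predU1P[->|/sw].
by rewrite /word_depth big_cons addrC -lerBrDr.
Qed.

Lemma mem_words V (d : {dot V for idfun}) n b w : neg_weight V ->
    {subset w <= adapted_basis d} -> word_depth w <= b -> (size w <= n)%N ->
  w \in words (adapted_basis d) n b.
Proof.
move=> nV; elim: n b w => [|n IH] b [|e w] //= sw.
have es : e \in adapted_basis d by rewrite sw ?mem_head.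
have sw' : {subset w <= adapted_basis d} by move=> x xw; rewrite sw // inE xw orbT.
rewrite /word_depth big_cons => le_b sz; rewrite inE /=; apply/flatten_mapP.
have := word_depth_ge0 nV sw'; rewrite /word_depth => w0.
exists e; first by rewrite mem_filter es andbT; lra.
by apply/mapP; exists w => //; apply: IH => //; rewrite /word_depth; lra.
Qed.

(** [max_length V] bounds the length of every word of depth at most [max_depth V]; the successor
    lets [words_sum] split off the empty word. *)
Definition words_of V (d : {dot V for idfun}) : seq (seq V) :=
  words (adapted_basis d) (max_length V).+1 (max_depth V).

Lemma mem_words_of V (d : {dot V for idfun}) w : neg_weight V ->
  {subset w <= adapted_basis d} -> word_depth w <= max_depth V -> w \in words_of d.
Proof.
move=> nV sw le_w; apply: mem_words => //; case: w sw le_w => // e w sw le_w.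
have e0 : e != 0 by apply/(@adapted_basis_neq0 _ _ d)/sw/mem_head.
have M0 : 0 < max_depth V.
  by apply: lt_le_trans (depth_gt0 nV e0) _; apply: (max_depthP V).2.
(* With [M = max_depth V] and [n = max_length V], each letter satisfies [M < n * depth e], so
   [size w * M <= n * word_depth w <= n * M]. *)
apply: leqW; rewrite -(ler_nat R) -(ler_pM2r M0).
apply: le_trans (ler_wpM2l _ le_w) => //; move: sw {le_w e0}.
rewrite /word_depth; elim: (e :: w) => [|f w' IH] sw; first by rewrite big_nil mul0r mulr0.
rewrite [size _]/= big_cons mulrDr -add1n natrD mulrDl mul1r lerD //.
  by apply/ltW/max_lengthP => //; apply/(@adapted_basis_neq0 _ _ d)/sw/mem_head.
by apply: IH => x xw; apply: sw; rewrite inE xw orbT.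
Qed.

Definition word_map V (d : {dot V for idfun}) (v : V) : 'rV[R]_(size (words_of d)) :=
  \row_j monomial d (nth [::] (words_of d) j) v.

Lemma wpoly_word_map V (d : {dot V for idfun}) (psi : 'rV_(size (words_of d)) -> R) :
  scalar psi -> wpoly (max_depth V) (psi \o word_map d).
Proof.
move=> /scalar_lin[_ _ _ psiZ psis].
have E v : \sum_j psi (delta_mx 0 j) * monomial d (nth [::] (words_of d) j) v =
    (psi \o word_map d) v.
  rewrite /= [word_map d v]row_sum_delta psis; apply: eq_bigr => j _.
  by rewrite psiZ mxE mulrC.
apply: wpoly_ext E _; apply: wpoly_sum => j _; apply: wpoly_scale.
have [M0 _] := max_depthP V.
have [sw le_w] := words_sub M0 (mem_nth [::] (ltn_ord j)).
exact: wpoly_le le_w (wpoly_monomial sw).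
Qed.

Lemma wpoly_factor V (d : {dot V for idfun}) p : neg_weight V ->
  wpoly (max_depth V) p ->
  exists2 xi : 'rV_(size (words_of d)) -> R, scalar xi & forall v, xi (word_map d v) = p v.
Proof.
move=> nV /(wpoly_words d)[S hS pE].
suff [xi xil xiE] : exists2 xi : 'rV_(size (words_of d)) -> R, scalar xi &
    forall v, xi (word_map d v) = \sum_(x <- S) x.1 * monomial d x.2 v.
  by exists xi => // v; rewrite pE.
elim: S hS {pE} => [|x S IH] hS.
  exists (fun _ => 0) => [c u v|v]; first by rewrite mulr0 addr0.
  by rewrite big_nil.
have [y yS|xi xil xiE] := IH; first by apply: hS; rewrite inE yS orbT.
have [sx le_x] := hS x (mem_head _ _); have hw := mem_words_of nV sx le_x.
have lt_i : (index x.2 (words_of d) < size (words_of d))%N by rewrite index_mem.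
exists (fun u : 'rV_(size (words_of d)) => x.1 * u 0 (Ordinal lt_i) + xi u) => [|v].
  by apply: scalar_lincomb xil => c u v; rewrite !mxE.
by rewrite big_cons xiE mxE nth_index.
Qed.

Lemma word_map_extend V (d : {dot V for idfun}) (E : vectType R) (h : V -> E) :
    neg_weight V -> (forall psi, scalar psi -> wpoly (max_depth V) (psi \o h)) ->
  exists T : 'Hom('rV_(size (words_of d)), E), forall v, T (word_map d v) = h v.
Proof.
move=> nV hh; pose X := vbasis {: E}.
have /choice[xi xiP] : forall i, exists xi : 'rV_(size (words_of d)) -> R,
    scalar xi /\ forall v, xi (word_map d v) = coord X i (h v).
  move=> i; have [xi xil xiE] := wpoly_factor d nV (hh _ (scalar_coord X i)).
  by exists xi.
have [|T TE] := @linear_lfun R _ E (fun u : 'rV_(size (words_of d)) => \sum_i xi i u *: X`_i).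
  move=> c u v; rewrite scaler_sumr -big_split /=; apply: eq_bigr => i _.
  by rewrite (xiP i).1 scalerDl scalerA.
exists T => v; rewrite TE [RHS](coord_vbasis (memvf (h v))).
by apply: eq_bigr => i _; rewrite (xiP i).2.
Qed.

End Words.

Section Linearization.
Context {R : realType}.
Implicit Types V W U : wspace R.

Lemma word_span_subproof V : exists B : {vspace 'rV[R]_(size (words_of (std_dot V)))},
  forall u, u \in B <-> exists l : seq (R * V), u = \sum_(x <- l) x.1 *: word_map (std_dot V) x.2.
Proof.
apply: vspace_of_setP; first by exists [::]; rewrite big_nil.
move=> c _ _ [l ->] [l' ->]; exists ([seq (c * x.1, x.2) | x <- l] ++ l').
rewrite big_cat big_map scaler_sumr /=; congr (_ + _).
by apply: eq_bigr => x _; rewrite scalerA.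
Qed.

Definition word_span V := projT1 (cid (word_span_subproof V)).

Lemma word_spanP V u : u \in word_span V <->
  exists l : seq (R * V), u = \sum_(x <- l) x.1 *: word_map (std_dot V) x.2.
Proof. exact: (projT2 (cid (word_span_subproof V)) u). Qed.

(** Permuted words give equal monomials, so the full coordinate space is in general larger than the
    span of the points; on the span, values at the points determine a linear map. *)
Definition lin_vect V : vectType R := subvs_of (word_span V).

Definition lin_iota V (v : V) : lin_vect V := vsproj (word_span V) (word_map (std_dot V) v).

Lemma lin_iotaE V (v : V) : vsval (lin_iota v) = word_map (std_dot V) v.
Proof.
rewrite vsprojK //; apply/word_spanP; exists [:: (1, v)].
by rewrite big_seq1 scale1r.
Qed.

Lemma lin_iota_span V (u : lin_vect V) :
  exists l : seq (R * V), u = \sum_(x <- l) x.1 *: lin_iota x.2.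
Proof.
have /word_spanP[l uE] := subvsP u; exists l; apply: val_inj => /=.
by rewrite linear_sum uE; apply: eq_bigr => x _; rewrite linearZ -lin_iotaE.
Qed.

Lemma lin_iota_ext V (E : vectType R) (f g : lin_vect V -> E) : linear f -> linear g ->
  (forall v, f (lin_iota v) = g (lin_iota v)) -> forall u, f u = g u.
Proof.
move=> /linear_lfun[F FE] /linear_lfun[G GE] h u; rewrite -FE -GE.
have [l ->] := lin_iota_span u; rewrite !linear_sum; apply: eq_bigr => x _.
by rewrite !linearZ /= FE GE h.
Qed.

Lemma lin_iota_scalar_ext V (f g : lin_vect V -> R) : scalar f -> scalar g ->
  (forall v, f (lin_iota v) = g (lin_iota v)) -> forall u, f u = g u.
Proof. exact: (@lin_iota_ext V R^o). Qed.

Lemma lin_iota_lfun_ext V (E : vectType R) (f g : 'Hom(lin_vect V, E)) :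
  (forall v, f (lin_iota v) = g (lin_iota v)) -> f = g.
Proof. by move=> h; apply/lfunP; apply: lin_iota_ext h; apply: linearP. Qed.

Lemma wpoly_lin_iota V (psi : lin_vect V -> R) : scalar psi ->
  wpoly (max_depth V) (psi \o @lin_iota V).
Proof.
move=> psil.
apply: (@wpoly_word_map _ V (std_dot V) (psi \o vsproj (word_span V))) => c u v.
by rewrite /= linearP psil.
Qed.

(** Existence half of the universal property, whose uniqueness half is [lin_iota_ext]: maps of
    weight at most [max_depth V] factor linearly through [lin_iota]. *)
Lemma lin_iota_extend V (E : vectType R) (h : V -> E) :
    neg_weight V -> (forall psi, scalar psi -> wpoly (max_depth V) (psi \o h)) ->
  exists T : 'Hom(lin_vect V, E), forall v, T (lin_iota v) = h v.
Proof.
move=> nV /(word_map_extend (std_dot V) nV)[T TE].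
have [|S SE] := @linear_lfun R (lin_vect V) E (fun u => T (vsval u)).
  by move=> c u v; rewrite !linearP.
by exists S => v; rewrite SE lin_iotaE.
Qed.

Section HyperplaneWeight.
Variables (E : vectType R) (eps : 'Hom(E, R^o)).

(** The weight only has to single out the hyperplane [eps = 0]; [-1] is an arbitrary negative
    value. *)
Definition hyperplane_wt (u : E) : \bar R :=
  if u == 0 then -oo%E else if eps u == 0 then (-1)%:E else 0%:E.

Lemma hyperplane_wt_le0 u : (hyperplane_wt u <= 0)%E.
Proof.
by rewrite /hyperplane_wt; do 2 case: ifP => // _; rewrite ?leNye // lee_fin lerN10.
Qed.

Lemma hyperplane_wt_lty u : (hyperplane_wt u < +oo)%E.
Proof. by rewrite /hyperplane_wt; do 2 case: ifP => // _; rewrite ?ltNyr // ltry. Qed.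

Lemma hyperplane_wt_eqNy u : hyperplane_wt u = -oo%E <-> u = 0.
Proof.
rewrite /hyperplane_wt; split=> [|->]; last by rewrite eqxx.
by case: eqP => // _; case: ifP.
Qed.

Lemma hyperplane_wtZ c u : c != 0 -> hyperplane_wt (c *: u) = hyperplane_wt u.
Proof.
by move=> c0; rewrite /hyperplane_wt linearZ !scaler_eq0 (negbTE c0) /=.
Qed.

Lemma hyperplane_wtD u v :
  (hyperplane_wt (u + v) <= maxe (hyperplane_wt u) (hyperplane_wt v))%E.
Proof.
rewrite le_max {1 3}/hyperplane_wt; case: eqP => [_|uv0]; first by rewrite leNye.
have epsD : eps (u + v) = eps u + eps v := linearD _ _ _.
rewrite epsD; case: ifP => [_|euv]; last first.
  have [eu|eu] := eqVneq (eps u) 0; last first.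
    apply/orP; left; rewrite /hyperplane_wt (negbTE eu) ifN //.
    by apply: contraNneq eu => ->; rewrite linear0.
  have ev : eps v != 0 by rewrite eu add0r in euv; rewrite euv.
  apply/orP; right; rewrite /hyperplane_wt (negbTE ev) ifN //.
  by apply: contraNneq ev => ->; rewrite linear0.
have h w : w != 0 -> ((-1)%:E <= hyperplane_wt w)%E.
  by rewrite /hyperplane_wt => /negbTE ->; case: ifP => // _; rewrite lee_fin lerN10.
have [u0|/h -> //] := eqVneq u 0; have [v0|/h ->] := eqVneq v 0; last by rewrite orbT.
by case: uv0; rewrite u0 v0 addr0.
Qed.

Definition hyperplane_weight : weight E :=
  Weight hyperplane_wt_lty hyperplane_wt_eqNy hyperplane_wtZ hyperplane_wtD.

End HyperplaneWeight.

(* The solutions chosen below exist, and are unique, when the weight of [V] is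
   negative; otherwise they are junk. *)
Definition lin_aug V : 'Hom(lin_vect V, R^o) :=
  xget 0 [set T : 'Hom(lin_vect V, R^o) | forall v, T (lin_iota v) = 1].

Definition lin V : wspace R := WSpace (hyperplane_weight (lin_aug V)).

Definition iota_of V (v : V) : lin V := lin_iota v.

Definition lin_proj V : 'Hom(lin V, V) :=
  xget 0 [set T : 'Hom(lin V, V) | forall v, T (iota_of v) = v].

Definition lin_map V W (f : V -> W) : 'Hom(lin V, lin W) :=
  xget 0 [set T : 'Hom(lin V, lin W) | forall v, T (iota_of v) = iota_of (f v)].

(** Grouped by depth of letters, this is the sum, over sequences of depths of total at most
    [max_depth V], of products of the inner products of the components of [x] and [y] of those
    depths. *)
Definition word_kernel V (d : {dot V for idfun}) (x y : V) : R :=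
  \sum_(w <- words_of d) monomial d w x * monomial d w y.

(** Specified by its values on the spanning points, which determine it. The first branch applies to
    negative weights, by the construction in [lin_dotP]. *)
Definition lin_dot V (d : {dot V for idfun}) : {dot lin V for idfun} :=
  match pselect (exists D : {dot lin V for idfun},
      forall x y, D (iota_of x) (iota_of y) = word_kernel d x y) with
  | left h => projT1 (cid h)
  | right _ => std_dot (lin V)
  end.

End Linearization.

(** * Topology *)

Section VectorTopology.
Context {R : realType}.
Implicit Types V E : vectType R.

Lemma cvg_initial (S : choiceType) (T : topologicalType) (f : S -> T) (F : set_system S) (s : S) :
  Filter F -> f x @[x --> F] --> f s -> F --> (s : initial_topology f).
Proof.
move=> FF cf A /= [_ [[B Bop <-] Bfs sBfA]].
by apply: filterS sBfA _; apply: cf; exact: open_nbhs_nbhs.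
Qed.

Lemma cvg_vtop E (T : Type) (F : set_system T) (h : T -> vtop E) (s : vtop E) : Filter F ->
    (forall i, coord (vbasis {: E}) i (h x : E) @[x --> F] --> coord (vbasis {: E}) i (s : E)) ->
  h x @[x --> F] --> s.
Proof.
move=> FF ch; apply: cvg_initial => A [P hP sPA] /=.
have FP : F (fun x => forall i j, P i j (passmx.rVof (vbasis {: E}) (h x : E) i j)).
  apply: filter_forall => i; apply: filter_forall => j.
  have Ps : nbhs (coord (vbasis {: E}) j (s : E)) (P i j) by have := hP i j; rewrite mxE.
  have := ch j _ Ps; rewrite nbhs_simpl /=; apply: filterS => x /=.
  by rewrite mxE.
rewrite /nbhs /= /fmap /=; apply: (filterS _ FP) => x hx.
exact: (sPA (passmx.rVof (vbasis {: E}) (h x : E)) hx).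
Qed.

Lemma cvg_sum_seq (T I : Type) (F : set_system T) (r : seq I) (f : I -> T -> R) (a : I -> R) :
  Filter F -> (forall i, f i x @[x --> F] --> a i) ->
  \sum_(i <- r) f i x @[x --> F] --> \sum_(i <- r) a i.
Proof.
move=> FF h; elim: r => [|i r IH].
  have -> : (fun x => \sum_(i <- [::]) f i x) = fun _ => 0 by apply/funext => x; rewrite big_nil.
  by rewrite big_nil; exact: cvg_cst.
have -> : (fun x => \sum_(j <- i :: r) f j x) = fun x => f i x + \sum_(j <- r) f j x.
  by apply/funext => x; rewrite big_cons.
by rewrite big_cons; exact: cvgD (h i) IH.
Qed.

Lemma scalar_continuous E (psi : E -> R) : scalar psi -> continuous (psi : vtop E -> R).
Proof.
move=> /scalar_lin[_ _ _ psiZ psis]; pose X := vbasis {: E}.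
have -> : psi = fun u => \sum_i coord X i u * psi X`_i.
  apply/funext => u; rewrite {1}(coord_vbasis (memvf u)) psis.
  by apply: eq_bigr => i _; rewrite psiZ.
move=> s; have FF : Filter (nbhs (s : vtop E)) by exact: nbhs_filter.
apply: (@cvg_sum_seq _ _ (nbhs (s : vtop E))) => i; apply: cvgM; last exact: cvg_cst.
have -> : coord X i = fun u => passmx.rVof X u 0 i by apply/funext => u; rewrite mxE.
pose g : vtop E -> 'rV[R]_(\dim {: E}) := passmx.rVof X.
have cg : g x @[x --> nbhs (s : vtop E)] --> g s by exact: initial_continuous.
exact: (cvg_comp g (fun u : 'rV[R]_(\dim {: E}) => u 0 i) cg (@coord_continuous _ _ _ 0 i (g s))).
Qed.

Lemma closed_eq0_family (T : topologicalType) (I : Type) (F : I -> T -> R) :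
  (forall i, continuous (F i)) -> closed [set x | forall i, F i x = 0].
Proof.
move=> cF; have -> : [set x | forall i, F i x = 0] = \bigcap_i (F i @^-1` [set 0]).
  by apply/seteqP; split=> x /= h i; [move=> _|]; apply: h.
apply: closed_bigI => i _; apply: preimage_closed; last exact: closed_eq.
by move=> x _; exact: cF.
Qed.

(** Makes every subspace closed: it is cut out by the coordinates of [u - projv U u]. *)
Lemma vspace_equations E (U : {vspace E}) : exists (I : Type) (F : I -> E -> R),
  (forall i, scalar (F i)) /\ forall u, u \in U <-> forall i, F i u = 0.
Proof.
exists 'I_(\dim {: E}), (fun i u => coord (vbasis {: E}) i (u - projv U u)).
split=> [i c u v|u].
  by rewrite (linearP (projv U)) -(scalar_coord (vbasis {: E}) i) scalerBr opprD addrACA.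
split=> [uU i|h]; first by rewrite projv_id // subrr linear0.
suff -> : u = projv U u by apply: memv_proj.
apply/eqP; rewrite -subr_eq0; apply/eqP; rewrite [LHS](coord_vbasis (memvf _)).
by rewrite big1 // => i _; rewrite h scale0r.
Qed.

End VectorTopology.

Section PointwiseTopology.
Context {R : realType}.
Implicit Types V W : wspace R.

Lemma wpoly_continuous V c (p : V -> R) : wpoly c p -> continuous (p : vtop V -> R).
Proof.
move=> hp s; have FF : Filter (nbhs (s : vtop V)) by exact: nbhs_filter.
suff : p x @[x --> nbhs (s : vtop V)] --> p s by [].
elim: hp => {c p} [c k _|c p q _ hp _ hq|b c c' phi p hphi _ hp _].
- exact: cvg_cst.
- exact: cvgD hp hq.
- apply: cvgM hp; exact: (scalar_continuous hphi.1 (x := s)).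
Qed.

Lemma cvg_vtop_scalar (E : vectType R) (T : Type) (F : set_system T) (h : T -> vtop E)
    (s : vtop E) : Filter F ->
    (forall psi : E -> R, scalar psi -> psi (h x) @[x --> F] --> psi s) ->
  h x @[x --> F] --> s.
Proof. by move=> FF ch; apply: cvg_vtop => i; apply: ch; exact: scalar_coord. Qed.

Lemma cvg_ptws (S T : Type) (U : topologicalType) (F : set_system T) (h : T -> {ptws S -> U})
    (s : {ptws S -> U}) : Filter F ->
  (forall v, h x v @[x --> F] --> s v) -> h x @[x --> F] --> s.
Proof. by move=> FF ch; apply/cvg_sup => v; apply: cvg_initial; exact: ch. Qed.

Lemma eval_continuous (S : eqType) (U : topologicalType) (v : S) :
  continuous (fun f : {ptws S -> U} => f v).
Proof. exact: (@proj_continuous S (fun=> U) v). Qed.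

End PointwiseTopology.

(** * Groups of subresonant maps *)

Section LinearizedMaps.
Context {R : realType}.
Implicit Types V W U : wspace R.

Lemma max_depth_compatible V W : compatible (wt V) (wt W) -> max_depth W = max_depth V.
Proof. by move=> [e _]; rewrite /max_depth e. Qed.

(** Pulling back by [f] keeps the bound [max_depth W]; by [eM] this is the bound under which maps
    out of [V] extend to [lin V]. *)
Lemma lin_mapE V W (f : V -> W) v : neg_weight V -> max_depth W = max_depth V ->
  sr_map f -> lin_map f (iota_of v) = iota_of (f v).
Proof.
move=> nV eM hf.
have [psi psil|T TE] := @lin_iota_extend _ V (lin_vect W) (@lin_iota _ W \o f) nV.
  by have := wpoly_comp hf (wpoly_lin_iota psil); rewrite eM.
have := @xgetPex _ 0 [set T : 'Hom(lin V, lin W) | forall v, T (iota_of v) = iota_of (f v)].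
by apply; exists T.
Qed.

Lemma lin_projE V (v : V) : neg_weight V -> lin_proj V (iota_of v) = v.
Proof.
move=> nV; have [psi psil|T TE] := @lin_iota_extend _ V V id nV.
  exact/wpoly_lin/form_le_max_depth.
have := @xgetPex _ 0 [set T : 'Hom(lin V, V) | forall v, T (iota_of v) = v].
by apply; exists T.
Qed.

Lemma lin_augE V (v : V) : neg_weight V -> lin_aug V (iota_of v) = 1.
Proof.
move=> nV; have [psi psil|T TE] := @lin_iota_extend _ V R^o (fun _ => 1) nV.
  by apply: wpoly_cst; case: (max_depthP V).
have := @xgetPex _ 0 [set T : 'Hom(lin_vect V, R^o) | forall v, T (lin_iota v) = 1].
by apply; exists T.
Qed.

Lemma lin_map_unique V W (f : V -> W) (T : 'Hom(lin V, lin W)) :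
    neg_weight V -> max_depth W = max_depth V -> sr_map f ->
  (forall v, T (iota_of v) = iota_of (f v)) -> lin_map f = T.
Proof. by move=> nV eM hf TE; apply: lin_iota_lfun_ext => v; rewrite TE; exact: lin_mapE. Qed.

Lemma lin_map_comp V W U (f : V -> W) (g : W -> U) : neg_weight V -> neg_weight W ->
    max_depth W = max_depth V -> max_depth U = max_depth V -> sr_map f -> sr_map g ->
  lin_map (g \o f) = (lin_map g \o lin_map f)%VF.
Proof.
move=> nV nW eW eU hf hg; apply: lin_map_unique => //; first exact: sr_map_comp.
by move=> v; rewrite comp_lfunE !lin_mapE // eU.
Qed.

Lemma lin_map_id V : neg_weight V -> lin_map (@id V) = \1%VF.
Proof.
move=> nV; apply: lin_map_unique => //; first exact: sr_map_id.
by move=> v; rewrite id_lfunE.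
Qed.

Lemma compatible_neg V W : compatible (wt V) (wt W) -> neg_weight V -> neg_weight W.
Proof.
move=> [e _] nV w w0; have : wt_values (wt W) (wt W w) by exact: wt_values_neq0.
by rewrite -e => -[v v0 <-]; exact: nV.
Qed.

End LinearizedMaps.

Section Groups.
Context {R : realType}.
Variable V : wspace R.
Hypothesis nV : neg_weight V.

Definition sr_iso (f : V -> V) :=
  sr_map f /\ exists g, [/\ sr_map g, cancel f g & cancel g f].

Lemma injective_D0_bij (f : V -> V) : polynomial_map f -> injective (D0 f) -> bijective (D0 f).
Proof.
move=> pf; have [A AE] := linear_lfun (D0_linear pf).
have -> : D0 f = A by apply/funext => v; rewrite AE.
by move=> /lker0P kA; exists (A^-1)%VF => v; rewrite ?lker0_lfunK ?lker0_lfunVK.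
Qed.

Lemma lin_map_inv (f g : V -> V) : sr_map f -> sr_map g -> cancel f g ->
  lker (lin_map f) == 0%VS /\ ((lin_map f)^-1)%VF = lin_map g.
Proof.
move=> hf hg fK.
have gf1 : (lin_map g \o lin_map f)%VF = \1%VF.
  by rewrite -lin_map_comp // -(lin_map_id nV); congr lin_map; apply/funext.
have kf : lker (lin_map f) == 0%VS.
  by apply/lker0P => u v uv; rewrite -[u]id_lfunE -[v]id_lfunE -gf1 !comp_lfunE uv.
split=> //; rewrite -[LHS]comp_lfun1l -gf1 -comp_lfunA lker0_compfV //.
by rewrite comp_lfun1r.
Qed.

(** [lin_map f] is an injective endomorphism in finite dimension, so its left inverse [lin_map g] is
    two-sided; applying [lin_proj] on points brings this back to [f] and [g]. *)
Lemma sr_left_inverse (f g : V -> V) : sr_map f -> sr_map g -> cancel f g -> cancel g f.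
Proof.
move=> hf hg fK v; have [/lker0_compfV] := lin_map_inv hf hg fK.
move=> /[swap] -> /(congr1 (fun T : 'End(lin V) => lin_proj V (T (iota_of v)))).
by rewrite /= comp_lfunE id_lfunE !lin_mapE // !lin_projE.
Qed.

Lemma GSRP (f : V -> V) : GSR V f <-> sr_iso f.
Proof.
split=> [[hf bf]|[hf [g [hg fK gK]]]].
  have [g hg fK] := PSR_left_inverse nV hf bf; have hf' := iffLR (PSRP f) hf.
  by split=> //; exists g; split=> //; exact: sr_left_inverse.
have hf' := iffRL (PSRP f) hf; split=> //; apply: injective_D0_bij; first by case: hf'.
apply: D0_inj_of_left_inverse fK; first by case: hf'.
by move=> phi phil; exists (max_depth V); apply/hg/form_le_max_depth.
Qed.

Lemma sr_iso_comp f g : sr_iso f -> sr_iso g -> sr_iso (f \o g).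
Proof.
move=> [hf [f' [hf' fK fK']]] [hg [g' [hg' gK gK']]]; split; first exact: sr_map_comp.
exists (g' \o f'); split; first exact: sr_map_comp.
- exact: can_comp.
- exact: can_comp.
Qed.

Lemma PSSR_Pstar (f : V -> V) : PSSR V V f -> Pstar V V f.
Proof.
move=> [pf hf]; split; first by split=> //; exact: ltW.
by apply: le_lt_trans hf; apply: ereal_sup_ubound; exists 1%N.
Qed.

Lemma sr_iso_id_plus (f : V -> V) : Pstar V V f -> sr_iso (fun x => x + f x).
Proof.
move=> hf; have hsr := iffLR (PSRP f) hf.1.
have hg : PSR V V (fun x => x + f x).
  apply/PSRP => b phi hphi; have [_ phiD _ _ _] := scalar_lin hphi.1.
  by apply: wpoly_ext (wpoly_add (wpoly_lin hphi) (hsr _ _ hphi)) => v /=; rewrite phiD.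
apply/GSRP; split=> //; apply: injective_D0_bij; first by case: hg.
have DE v : D0 (fun x => x + f x) v = v + D0 f v.
  apply: D0_unique => [|phi phil]; first by case: hg.
  have [_ phiD _ phiZ _] := scalar_lin phil.
  have [q [qE q1]] := D0_ray hf.1.1 v phil; exists (phi v *: 'X + q); split=> [t|].
    by rewrite phiD phiZ qE hornerD hornerZ hornerX mulrC.
  by rewrite coefD coefZ coefX mulr1 q1 phiD.
have D_lt v : v != 0 -> (wt V (D0 f v) < wt V v)%E.
  move=> v0; have : (wt V (D0 f v) - \sum_(i < 1) wt V v < 0)%E.
    by apply: le_lt_trans hf.2; apply: ereal_sup_ubound; exists (fun=> v).
  by rewrite big_ord_recl big_ord0 adde0 (wt_depth v0) lteBlDr // add0e.
have Dlin := D0_linear hf.1.1.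
move=> u v; rewrite !DE => uv; apply/eqP; rewrite -subr_eq0; apply/negPn/negP => w0.
(* A nonzero kernel vector of the derivative of [x + f x] would be sent by [D0 f] to its opposite,
   which has the same weight, whereas [D0 f] lowers weights strictly. *)
have := D_lt _ w0; have -> : D0 f (u - v) = -1 *: (u - v).
  have -> : D0 f (u - v) = D0 f u - D0 f v.
    by rewrite addrC -scaleN1r Dlin scaleN1r addrC.
  rewrite scaleN1r opprB; apply/eqP; rewrite subr_eq addrAC -subr_eq opprK.
  by rewrite [D0 f u + u]addrC uv addrC.
by rewrite wtZ ?ltxx // oppr_eq0 oner_eq0.
Qed.

(** Common form of the three groups, with [X] equal to [wpoly], [strict] or [star], so that the Lie
    group argument is made once. *)
Definition sr_subgroup (X : R -> (V -> R) -> Prop) : set (V -> V) :=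
  [set f | sr_iso f /\ forall b phi, form_le b phi -> X b (fun v => phi (f v) - phi v)].

Lemma GSR_subgroup : GSR V = sr_subgroup (@wpoly _ V).
Proof.
apply/seteqP; split=> f /= => [/GSRP hf|[/GSRP]//]; split=> // b phi hphi.
by apply: wpoly_sub; [exact: hf.1|exact: wpoly_lin].
Qed.

Lemma id_plus_subgroup (P : set (V -> V)) (X : R -> (V -> R) -> Prop) :
    P `<=` Pstar V V -> (forall f, P f <-> forall b phi, form_le b phi -> X b (phi \o f)) ->
  [set (fun x => x + f x) | f in P] = sr_subgroup X.
Proof.
move=> sP hP; apply/seteqP; split=> [_ [f hf <-]|f [hf hX]] /=.
  split; first exact/sr_iso_id_plus/sP.
  move=> b phi hphi; have [_ phiD _ _ _] := scalar_lin hphi.1.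
  have -> : (fun v => phi (v + f v) - phi v) = phi \o f.
    by apply/funext => v; rewrite phiD addrAC subrr add0r.
  exact: (iffLR (hP f)).
exists (fun v => f v - v); last by apply/funext => v; rewrite addrC subrK.
apply/hP => b phi hphi; have [_ _ phiB _ _] := scalar_lin hphi.1.
have -> : phi \o (fun v => f v - v) = fun v => phi (f v) - phi v.
  by apply/funext => v; rewrite /= phiB.
exact: hX.
Qed.

Lemma GSSR_subgroup : GSSR V = sr_subgroup (@strict _ V).
Proof. by apply: id_plus_subgroup => [f|f]; [exact: PSSR_Pstar|exact: PSSRP]. Qed.

Lemma Gstar_subgroup : Gstar V = sr_subgroup (@star _ V).
Proof. by apply: id_plus_subgroup => // f; exact: PstarP. Qed.

Lemma Gstar_sub_GSR : Gstar V `<=` GSR V.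
Proof. by move=> _ [f hf <-]; apply/GSRP/sr_iso_id_plus. Qed.

Lemma GSSR_sub_Gstar : GSSR V `<=` Gstar V.
Proof. by move=> _ [f /PSSR_Pstar hf <-]; exists f. Qed.

Section LieIsomorphism.
Variable X : R -> (V -> R) -> Prop.
Hypotheses (X0 : forall b, X b (fun _ => 0))
  (XD : forall b p q, X b p -> X b q -> X b (fun v => p v + q v))
  (XZ : forall b k p, X b p -> X b (fun v => k * p v))
  (Xwpoly : forall b p, X b p -> wpoly b p)
  (Xcomp : forall b p f, sr_map f -> X b p -> X b (p \o f)).

Let G := sr_subgroup X.

Lemma sr_subgroup_id : G id.
Proof.
split; first by split; [exact: sr_map_id|exists id; split=> //; exact: sr_map_id].
move=> b phi hphi; have -> : (fun v : V => phi v - phi v) = fun _ => 0.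
  by apply/funext => v; rewrite subrr.
exact: X0.
Qed.

Lemma sr_subgroup_comp f g : G f -> G g -> G (f \o g).
Proof.
move=> [hf hXf] [hg hXg]; split; first exact: sr_iso_comp.
move=> b phi hphi; have -> : (fun v => phi ((f \o g) v) - phi v) =
    fun v => ((fun v => phi (f v) - phi v) \o g) v + (phi (g v) - phi v).
  by apply/funext => v; rewrite /= addrA subrK.
by apply: XD; [apply: (Xcomp hg.1); exact: hXf|exact: hXg].
Qed.

Lemma sr_subgroup_inv f : G f -> exists2 g, G g & cancel f g /\ cancel g f.
Proof.
move=> [[hf [g [hg fK gK]]] hX]; exists g => //; split.
  by split=> //; exists f.
move=> b phi hphi.
have -> : (fun v => phi (g v) - phi v) =
    fun v => -1 * ((fun v => phi (f v) - phi v) \o g) v.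
  by apply/funext => v; rewrite /= gK mulN1r opprB.
by apply/XZ/Xcomp => //; exact: hX.
Qed.

Lemma sr_subgroup_sr f : G f -> sr_map f.
Proof. by move=> [[]]. Qed.

Definition lin_closed_set : set 'End(lin V) :=
  [set g | (forall v, iota_of (lin_proj V (g (iota_of v))) = g (iota_of v)) /\
    forall b phi, form_le b phi -> X b (fun v => phi (lin_proj V (g (iota_of v))) - phi v)].

(** An endomorphism [g] preserving the set of points [iota_of v] is the linearization of the map it
    induces there, and the condition with [X] makes that map subresonant. *)
Lemma lin_image_closed_set : @lin_map R V V @` G = lin_closed_set `&` @GL _ (lin V).
Proof.
apply/seteqP; split=> [_ [f hf <-]|g [[g1 g2] /= kg]].
  have [[hsr [f' [hf' fK fK']]] hX] := hf; have [kf _] := lin_map_inv hsr hf' fK.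
  split=> //; split=> [v|b phi hphi]; first by rewrite !lin_mapE // lin_projE.
  have -> : (fun v => phi (lin_proj V (lin_map f (iota_of v))) - phi v) =
      fun v => phi (f v) - phi v.
    by apply/funext => v; rewrite lin_mapE // lin_projE.
  exact: hX.
pose f v := lin_proj V (g (iota_of v)).
have hf : sr_map f.
  move=> b phi hphi; have -> : phi \o f = fun v => phi (f v) - phi v + phi v.
    by apply/funext => v; rewrite subrK.
  by apply: wpoly_add; [exact/Xwpoly/g2|exact: wpoly_lin].
have Lf : lin_map f = g by apply: lin_map_unique => // v; rewrite g1.
exists f => //; split=> //; apply/GSRP.
have hf' := iffRL (PSRP f) hf; split=> //; apply: injective_D0_bij; first by case: hf'.
(* [h] is not yet known to be subresonant, but a polynomial left inverse suffices for injectivity of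
   [D0 f]; [GSRP] then supplies the subresonant inverse. *)
pose h v := lin_proj V ((g^-1)%VF (iota_of v)).
apply: (@D0_inj_of_left_inverse _ _ _ f h); first by case: hf'.
  move=> phi phil; exists (max_depth V).
  apply: (@wpoly_lin_iota _ V (fun u => phi (lin_proj V ((g^-1)%VF u)))) => c u v.
  by rewrite !linearP phil.
by move=> v; rewrite /h g1 lker0_lfunK // lin_projE.
Qed.

Lemma lin_eval_continuous (E : vectType R) (T : 'Hom(lin V, E)) v :
  continuous (fun g : vtop 'End(lin V) => T ((g : 'End(lin V)) (iota_of v)) : vtop E).
Proof.
move=> g; have FF : Filter (nbhs (g : vtop 'End(lin V))) by exact: nbhs_filter.
apply: cvg_vtop_scalar => psi psil.
apply: (@scalar_continuous _ _ (fun g : 'End(lin V) => psi (T (g (iota_of v))))) => c g1 g2.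
by rewrite add_lfunE scale_lfunE linearP psil.
Qed.

Lemma lin_closed_set_closed : closed (lin_closed_set : set (vtop 'End(lin V))).
Proof.
have -> : (lin_closed_set : set (vtop 'End(lin V))) =
   [set g : vtop 'End(lin V) | forall i : V * {psi : lin V -> R | scalar psi},
      projT1 i.2 (iota_of (lin_proj V ((g : 'End(lin V)) (iota_of i.1)))) -
      projT1 i.2 ((g : 'End(lin V)) (iota_of i.1)) = 0] `&`
   \bigcap_(i : {x : R * (V -> R) | form_le x.1 x.2})
     [set g : vtop 'End(lin V) | X (projT1 i).1
        (fun v => (projT1 i).2 (lin_proj V ((g : 'End(lin V)) (iota_of v))) - (projT1 i).2 v)].
  apply/seteqP; split=> g /=.
    move=> [g1 g2]; split=> [[v [psi psil]] /=|[[b phi] /= hphi] _]; last exact: g2.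
    by rewrite g1 subrr.
  move=> [g1 g2]; split=> [v|b phi hphi].
    apply: scalar_separates => psi psil; apply/eqP; rewrite -subr_eq0; apply/eqP.
    exact: (g1 (v, exist _ psi psil)).
  exact: (g2 (exist _ (b, phi) hphi) I).
apply: closedI.
  apply: closed_eq0_family => -[v [psi psil]] /= g.
  have FF : Filter (nbhs (g : vtop 'End(lin V))) by exact: nbhs_filter.
  apply: cvgB.
    (* This equation is not linear in [g], but it is an evaluation followed by the polynomial
       [psi \o iota_of]. *)
    apply: (@continuous_comp _ _ _ (fun g : vtop 'End(lin V) =>
      lin_proj V ((g : 'End(lin V)) (iota_of v)) : vtop V) (fun x : vtop V => psi (iota_of x))).
      exact: lin_eval_continuous.
    exact: (wpoly_continuous (wpoly_lin_iota psil)).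
  apply: (@scalar_continuous _ _ (fun g : 'End(lin V) => psi (g (iota_of v)))) => c g1 g2.
  by rewrite add_lfunE scale_lfunE psil.
apply: closed_bigI => -[[b phi] /= hphi] _; have [phi0 phiD _ phiZ _] := scalar_lin hphi.1.
(* The condition with [X] is affine in [g]: it says that [g - \1] lies in a subspace [U] of
   endomorphisms. Subspaces are closed, so no closedness of [X] itself enters. *)
have [|c g h gX hX|U hU] := @vspace_of_setP _ 'End(lin V)
    [set g | X b (fun v => phi (lin_proj V (g (iota_of v))))].
- rewrite /=; have -> : (fun v => phi (lin_proj V ((0 : 'End(lin V)) (iota_of v)))) = fun _ => 0.
    by apply/funext => v; rewrite lfunE /= linear0 phi0.
  exact: X0.
- rewrite /=; have -> : (fun v => phi (lin_proj V ((c *: g + h) (iota_of v)))) =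
      fun v => c * phi (lin_proj V (g (iota_of v))) + phi (lin_proj V (h (iota_of v))).
    by apply/funext => v; rewrite add_lfunE scale_lfunE linearP hphi.1.
  by apply: XD => //; exact: XZ.
have [I [F [Flin FE]]] := vspace_equations U.
have subE (g : 'End(lin V)) : (fun v => phi (lin_proj V ((g - \1%VF) (iota_of v)))) =
    fun v => phi (lin_proj V (g (iota_of v))) - phi v.
  apply/funext => v; rewrite add_lfunE opp_lfunE id_lfunE linearB /= lin_projE //.
  by case: (scalar_lin hphi.1).
have -> : [set g : vtop 'End(lin V) |
      X b (fun v => phi (lin_proj V ((g : 'End(lin V)) (iota_of v))) - phi v)] =
    [set g : vtop 'End(lin V) | forall i, F i (g : 'End(lin V)) - F i \1%VF = 0].
  apply/seteqP; split=> g /=; rewrite -subE.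
    move=> hg; have /FE h : (g : 'End(lin V)) - \1%VF \in U by exact/hU.
    by move=> i; rewrite -[RHS](h i); case: (scalar_lin (Flin i)).
  move=> h; suff /hU : (g : 'End(lin V)) - \1%VF \in U by [].
  by apply/FE => i; rewrite -[RHS](h i); case: (scalar_lin (Flin i)).
apply: closed_eq0_family => i g.
have FF : Filter (nbhs (g : vtop 'End(lin V))) by exact: nbhs_filter.
by apply: cvgB; [exact: (scalar_continuous (Flin i) (x := g))|exact: cvg_cst].
Qed.

End LieIsomorphism.
End Groups.

Section LieIsomorphisms.
Context {R : realType}.

(** Pointwise convergence suffices, because a linear form on ['End(E)] is a combination of matrix
    coefficients; [Eij (i, j)] sends the basis vector of index [i] to that of index [j] and the
    others to [0]. *)
Lemma cvg_End (E : vectType R) (T : Type) (F : set_system T) (h : T -> vtop 'End(E))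
    (s : vtop 'End(E)) : Filter F ->
  (forall u, ((h x : 'End(E)) u : vtop E) @[x --> F] --> ((s : 'End(E)) u : vtop E)) ->
  h x @[x --> F] --> s.
Proof.
move=> FF ch; apply: cvg_vtop_scalar => psi psil; pose X := vbasis {: E}.
have /choice[Eij EijE] : forall ij : 'I_(\dim {: E}) * 'I_(\dim {: E}),
    exists A : 'End(E), forall u, A u = coord X ij.1 u *: X`_ij.2.
  by move=> ij; apply: linear_lfun => c u v; rewrite linearP scalerDl scalerA.
have [_ _ _ psiZ psis] := scalar_lin psil.
have E0 (g : 'End(E)) : psi g =
    \sum_(i < \dim {: E}) \sum_(j < \dim {: E}) coord X j (g X`_i) * psi (Eij (i, j)).
  have {1}-> : g = \sum_(i < \dim {: E}) \sum_(j < \dim {: E}) coord X j (g X`_i) *: Eij (i, j).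
    apply/lfunP => u; rewrite {1}(coord_vbasis (memvf u)) linear_sum sum_lfunE.
    apply: eq_bigr => i _; rewrite linearZ sum_lfunE /= {1}(coord_vbasis (memvf (g _))).
    rewrite scaler_sumr; apply: eq_bigr => j _.
    by rewrite scale_lfunE EijE !scalerA mulrC.
  rewrite psis; apply: eq_bigr => i _; rewrite psis; apply: eq_bigr => j _.
  by rewrite psiZ.
have -> : (fun x => psi (h x)) =
    fun x => \sum_(i < \dim {: E}) \sum_(j < \dim {: E})
      coord X j ((h x : 'End(E)) X`_i) * psi (Eij (i, j)).
  by apply/funext => x; rewrite E0.
rewrite E0; apply: cvg_sum_seq => i; apply: cvg_sum_seq => j; apply: cvgM; last exact: cvg_cst.
exact: (cvg_comp (fun x => (h x : 'End(E)) X`_i : vtop E) (coord X j : vtop E -> R)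
  (ch X`_i) (scalar_continuous (scalar_coord X j) (x := _))).
Qed.

Variable V : wspace R.
Hypothesis nV : neg_weight V.
Variable X : R -> (V -> R) -> Prop.
Hypotheses (X0 : forall b, X b (fun _ => 0))
  (XD : forall b p q, X b p -> X b q -> X b (fun v => p v + q v))
  (XZ : forall b k p, X b p -> X b (fun v => k * p v))
  (Xwpoly : forall b p, X b p -> wpoly b p)
  (Xcomp : forall b p f, sr_map f -> X b p -> X b (p \o f)).

Lemma sr_subgroup_Lie : Lie_isomorphism (sr_subgroup X) (@lin_map R V V).
Proof.
have Gid := @sr_subgroup_id _ V X X0.
have Gcomp := @sr_subgroup_comp _ V X XD Xcomp.
have Ginv := @sr_subgroup_inv _ V X XZ Xcomp.
have L1 := lin_map_id nV.
have LM (f g : V -> V) : sr_subgroup X f -> sr_subgroup X g ->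
    lin_map (f \o g) = (lin_map f \o lin_map g)%VF.
  by move=> /sr_subgroup_sr hf /sr_subgroup_sr hg; exact: lin_map_comp.
split=> //.
- split; last first.
    exists (lin_closed_set X : set (vtop 'End(lin V))); first exact: lin_closed_set_closed.
    exact: lin_image_closed_set.
  split.
  + by rewrite lin_image_closed_set // => g [].
  + by exists id.
  + move=> _ _ [f hf <-] [g hg <-]; rewrite -LM //; exists (f \o g) => //.
    exact: Gcomp.
  + move=> _ [f hf <-]; have [g hg [fK gK]] := Ginv f hf.
    have [_ ->] := lin_map_inv nV (sr_subgroup_sr hf) (sr_subgroup_sr hg) fK.
    by exists g.
- apply/subspace_continuousP => f hf.
  set F := within _ _; have FF : Filter F by exact: within_filter.
  apply: cvg_End => u; apply: cvg_vtop_scalar => psi psil.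
  have [_ _ _ psiZ psis] := scalar_lin psil; have [l uE] := lin_iota_span u.
  (* [u] is a finite combination of points, so this coefficient of [lin_map g] is polynomial in
     finitely many values of [g]. *)
  pose Phi (g : {ptws V -> vtop V}) := \sum_(x <- l) x.1 * psi (iota_of (g x.2 : V)).
  have PhiE (g : V -> V) : sr_subgroup X g -> psi (lin_map g u) = Phi g.
    move=> /sr_subgroup_sr hg; rewrite uE linear_sum psis; apply: eq_bigr => x _.
    by rewrite linearZ psiZ; congr (_ * psi _); exact: lin_mapE.
  rewrite PhiE //.
  apply: (@cvg_trans _ (Phi g @[g --> F])).
    by apply: fmap_within_eq => g; rewrite inE => hg; exact: PhiE.
  apply: cvg_within_filter; apply: cvg_sum_seq => x; apply: cvgM; first exact: cvg_cst.
  exact: (cvg_comp (fun g : {ptws V -> vtop V} => g x.2) (psi \o @iota_of R V : vtop V -> R)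
    (@eval_continuous V (vtop V) x.2 f) (wpoly_continuous (wpoly_lin_iota psil) (x := _))).
(* The inverse isomorphism recovers [f] from its action on points; for each [v] it is linear in
   [g]. *)
- exists (fun g v => lin_proj V (g (iota_of v))) => [f /sr_subgroup_sr hf|].
    by apply/funext => v; rewrite lin_mapE // lin_projE.
  apply/subspace_continuousP => g _; apply: cvg_within_filter; apply: cvg_ptws => v.
  exact: lin_eval_continuous.
Qed.

End LieIsomorphisms.

(** * Unipotence of linearized maps *)

Section Unipotence.
Context {R : realType}.
Variables (V : wspace R) (f : V -> V).
Hypothesis nV : neg_weight V.

(** The pullback by [f] minus the identity, that is, the transpose of [lin_map f - 1]. *)
Let delta (p : V -> R) : V -> R := fun v => p (f v) - p v.
Let nil n p := forall v, iter n delta p v = 0.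

Lemma nil_delta n p : nil n.+1 p = nil n (delta p).
Proof. by rewrite /nil; under eq_forall do rewrite iterSr. Qed.

Lemma nil0 n : nil n (fun _ => 0).
Proof.
elim: n => // n IH; rewrite nil_delta.
by have -> : delta (fun _ => 0) = fun _ => 0 by apply/funext => v; rewrite /delta subrr.
Qed.

Lemma nil_le n m p : (n <= m)%N -> nil n p -> nil m p.
Proof.
elim: n m p => [|n IH] [|m] p //; last by rewrite ltnS !nil_delta; exact: IH.
by move=> _ /funext /= ->; exact: nil0.
Qed.

Lemma nilD n p q : nil n p -> nil n q -> nil n (fun v => p v + q v).
Proof.
elim: n p q => [|n IH] p q; first by move=> hp hq v /=; rewrite [p v]hp [q v]hq addr0.
rewrite !nil_delta => hp hq.
have -> : delta (fun v => p v + q v) = fun v => delta p v + delta q v.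
  by apply/funext => v; rewrite /delta opprD addrACA.
exact: IH.
Qed.

(* [delta (p q) = delta p * q + p * delta q + delta p * delta q] *)
Lemma nilM n m p q : nil n p -> nil m q -> nil (n + m)%N (fun v => p v * q v).
Proof.
have [N] := ubnP (n + m); elim: N n m p q => // N IH n m p q; rewrite ltnS => le_N hp hq.
case: n hp le_N => [|n] hp le_N.
  have -> : (fun v => p v * q v) = fun _ => 0 by apply/funext => v; rewrite [p v]hp mul0r.
  exact: nil0.
case: m hq le_N => [|m] hq le_N.
  have -> : (fun v => p v * q v) = fun _ => 0 by apply/funext => v; rewrite [q v]hq mulr0.
  exact: nil0.
have hp' := hp; have hq' := hq; rewrite !nil_delta in hp' hq'.
rewrite addSn nil_delta.
have -> : delta (fun v => p v * q v) = fun v =>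
    (delta p v * q v + p v * delta q v) + delta p v * delta q v.
  by apply/funext => v; rewrite /delta; ring.
apply: nilD; first apply: nilD.
- by apply: IH.
- by have := IH n.+1 m p (delta q); rewrite addSnnS; apply=> //; rewrite -addSnnS.
- apply: (@nil_le (n + m)); first by rewrite addnS.
  by apply: IH => //; apply: leq_ltn_trans le_N; rewrite leq_add2l.
Qed.

Lemma wpoly_nil : (forall b phi, form_le b phi -> star b (fun v => phi (f v) - phi v)) ->
  forall c p, wpoly c p -> exists n, nil n p.
Proof.
move=> hf.
have nilD' p q : (exists n, nil n p) -> (exists n, nil n q) ->
    exists n, nil n (fun v => p v + q v).
  move=> [n hn] [m hm]; exists (n + m)%N; apply: nilD.
    exact: nil_le (leq_addr _ _) hn.
  exact: nil_le (leq_addl _ _) hm.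
have nilM' p q : (exists n, nil n p) -> (exists n, nil n q) ->
    exists n, nil n (fun v => p v * q v).
  by move=> [n hn] [m hm]; exists (n + m)%N; exact: nilM.
apply: (wpoly_algebra_ind (Q := fun _ p => exists n, nil n p) nV).
- by move=> _; exists 0%N.
- by move=> _ k _; exists 1%N => v /=; rewrite /delta subrr.
- by move=> _; exact: nilD'.
- by move=> _ _ _ p q hp hq _; exact: nilM'.
move=> b phi hphi IH.
have [n hn] : exists n, nil n (delta phi).
  have := hf b phi hphi; rewrite -/(delta phi).
  elim=> [|p q _ hp _ hq|c c' p q hp hq cb c'b _]; [by exists 0%N|exact: nilD'|].
  by apply: nilM'; [exact: IH hp|exact: IH hq].
by exists n.+1; rewrite nil_delta.
Qed.

(** By transposition, coordinates of iterates of [N] at points are iterates of [delta] on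
    polynomials. The exponent is the maximum over a basis of coordinate forms. *)
Lemma lin_map_unipotent : Gstar V f ->
  exists n, forall u, iter n (fun x => lin_map f x - x) u = 0.
Proof.
rewrite Gstar_subgroup // => -[[hf _] hX]; pose N (x : lin V) := lin_map f x - x.
have Nlin : linear N by move=> c u v; rewrite /N linearP opprD scalerBr addrACA.
have iterN n : linear (iter n N).
  by elim: n => // n IH c u v; rewrite /= IH Nlin.
have E n psi v : scalar psi -> psi (iter n N (iota_of v)) = iter n delta (psi \o @iota_of R V) v.
  elim: n psi v => // n IH psi v psil; rewrite [iter n.+1 N _]iterS iterSr.
  rewrite -[psi _]/((psi \o N) _) IH; last exact: scalar_comp.
  congr (iter n delta _ v); apply/funext => w.
  by rewrite /delta /= /N lin_mapE //; have [_ _ ->] := scalar_lin psil.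
pose Y := vbasis {: lin V}.
have /choice[n hn] : forall i, exists n, nil n (coord Y i \o @iota_of R V).
  by move=> i; apply: wpoly_nil hX _ _ (wpoly_lin_iota (scalar_coord Y i)).
exists (\max_i n i)%N; apply: (@lin_iota_ext R V _ _ (fun _ => 0)) => [|c u v|v].
- exact: iterN.
- by rewrite scaler0 addr0.
rewrite [LHS](coord_vbasis (memvf _)) big1 // => i _.
rewrite (E _ (coord Y i) v (scalar_coord Y i)).
by rewrite (nil_le (leq_bigmax i) (hn i)) scale0r.
Qed.

End Unipotence.

(** * The inner product *)

Section LinearizedInnerProduct.
Context {R : realType}.
Implicit Types V W : wspace R.

Lemma lin_dotP V (d : {dot V for idfun}) : neg_weight V ->
  exists T : 'Hom(lin V, 'rV[R]_(size (words_of d))),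
    (forall v, T (iota_of v) = word_map d v) /\
    forall a b, lin_dot d a b = \sum_j T a 0 j * T b 0 j.
Proof.
move=> nV; have [psi|T TE] := @lin_iota_extend _ V _ (word_map d) nV.
  exact: wpoly_word_map.
exists T; split=> //.
(* [S] inverts [T] on points, so [T] is injective and the standard inner product pulls back along
   it. *)
have [psi|S SE] := @word_map_extend _ V d (lin_vect V) (@lin_iota _ V) nV.
  exact: wpoly_lin_iota.
have kT : lker T = 0%VS.
  apply/eqP/lker0P => u v uv.
  suff K w : S (T w) = w by rewrite -(K u) uv K.
  apply: (@lin_iota_ext R V _ (fun w => S (T w)) id) => // [c x y|x]; first by rewrite !linearP.
  by rewrite TE SE.
have [D DE] := dot_pullback kT.
have DK x y : D (iota_of x) (iota_of y) = word_kernel d x y.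
  rewrite DE /word_kernel (big_nth [::]) big_mkord; apply: eq_bigr => j _.
  by rewrite !TE !mxE.
have LK x y : lin_dot d (iota_of x) (iota_of y) = word_kernel d x y.
  rewrite /lin_dot; case: pselect => [h|[]]; last by exists D.
  exact: (projT2 (cid h)).
move=> a b; rewrite -DE.
apply: (lin_iota_scalar_ext (f := lin_dot d a) (g := D a)) => [||y]; try exact: dot_scalar.
rewrite (dotC (lin_dot d)) (dotC D).
apply: (lin_iota_scalar_ext (f := lin_dot d (iota_of y)) (g := D (iota_of y))) => [||x];
  try exact: dot_scalar.
by rewrite LK DK.
Qed.

Lemma lin_dot_iota V (d : {dot V for idfun}) x y : neg_weight V ->
  lin_dot d (iota_of x) (iota_of y) = word_kernel d x y.
Proof.
move=> /(lin_dotP d)[T [TE ->]].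
rewrite /word_kernel (big_nth [::]) big_mkord; apply: eq_bigr => j _.
by rewrite !TE !mxE.
Qed.

Lemma monomial_cons V (d : {dot V for idfun}) e w v :
  monomial d (e :: w) v = d e v * monomial d w v.
Proof. by rewrite /monomial big_cons. Qed.

Lemma monomial_scale V (d : {dot V for idfun}) w t v :
  monomial d w (t *: v) = t ^+ size w * monomial d w v.
Proof.
elim: w => [|e w IH]; first by rewrite /monomial !big_nil mul1r.
by rewrite !monomial_cons IH dotZr exprS; ring.
Qed.

Lemma word_kernel0 V (d : {dot V for idfun}) y : word_kernel d 0 y = 1.
Proof.
rewrite /word_kernel /words_of words_sum /monomial !big_nil mul1r big1 ?addr0 // => e _.
by rewrite big1 // => w _; rewrite big_cons dot0r !mul0r.
Qed.

(** At [0] only the empty word survives in the kernel. Orthogonality of [iota_of 0] to the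
    hyperplane follows. *)
Lemma lin_dot_iota0 V (d : {dot V for idfun}) u : neg_weight V ->
  lin_dot d (iota_of 0) u = lin_aug V u.
Proof.
move=> nV; apply: (lin_iota_scalar_ext (f := lin_dot d (iota_of 0)) (g := lin_aug V)) => [||v].
- exact: dot_scalar.
- exact: scalar_hom.
by rewrite -[lin_iota v]/(iota_of v) lin_dot_iota // word_kernel0 lin_augE.
Qed.

Lemma polynomial_map_iota V : polynomial_map (@iota_of R V).
Proof.
by apply: polynomial_map_wpoly => psi psil; exists (max_depth V); exact: wpoly_lin_iota.
Qed.

Lemma words_sum_nil V (s : seq V) n b (k : R) :
  \sum_(w <- words s n b) (size w == 0)%:R * k = k.
Proof.
case: n => [|n]; first by rewrite big_seq1 mul1r.
rewrite words_sum mul1r big1 ?addr0 // => e _.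
by rewrite big1 // => w _; rewrite mul0r.
Qed.

Lemma dot_adapted V (d : {dot V for idfun}) u v :
  d u v = \sum_(e <- adapted_basis d) d e u * d e v.
Proof.
rewrite (scalar_adapted_basis d v (dot_scalar d u)); apply: eq_bigr => e _.
by rewrite mulrC (dotC d u e).
Qed.

(** Only one-letter monomials have a nonzero linear coefficient, and their sum is the expansion of
    [d u v] in the basis. *)
Lemma lin_dot_D0 V (d : {dot V for idfun}) u v : neg_weight V ->
  lin_dot d (D0 (@iota_of R V) u) (D0 (@iota_of R V) v) = d u v.
Proof.
move=> nV; have [T [TE ->]] := lin_dotP d nV.
have TD x j : T (D0 (@iota_of R V) x) 0 j =
    (size (nth [::] (words_of d) j) == 1)%:R * monomial d (nth [::] (words_of d) j) x.
  have hl : scalar (fun a => T a 0 j) by move=> c a b; rewrite linearP !mxE.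
  have [q [qE <-]] := D0_ray (polynomial_map_iota V) x hl.
  have -> : q = monomial d (nth [::] (words_of d) j) x *: 'X^(size (nth [::] (words_of d) j)).
    apply: poly_horner_inj => t; rewrite -qE TE mxE monomial_scale hornerZ hornerXn.
    by rewrite mulrC.
  by rewrite coefZ coefXn eq_sym mulrC.
under eq_bigr => j _ do rewrite !TD.
have := big_mkord xpredT (fun j => (size (nth [::] (words_of d) j) == 1)%:R *
  monomial d (nth [::] (words_of d) j) u * ((size (nth [::] (words_of d) j) == 1)%:R *
  monomial d (nth [::] (words_of d) j) v)) => <-.
rewrite -(big_nth [::] xpredT (fun w => (size w == 1)%:R * monomial d w u *
  ((size w == 1)%:R * monomial d w v))) words_sum !mul0r add0r.
rewrite [RHS]dot_adapted big_mkcond [LHS]big_seq [RHS]big_seq; apply: eq_bigr => e es.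
(* The bound on depths admits every basis vector as a one-letter word, so no term of [d u v] is
   lost. *)
rewrite (max_depthP V).2 ?(adapted_basis_neq0 es) //.
rewrite -[RHS](words_sum_nil (adapted_basis d) (max_length V) (max_depth V - depth e)).
apply: eq_bigr => -[|f w] _ /=; last by rewrite !mul0r.
by rewrite /monomial !big_seq1 !mul1r.
Qed.

(** * Invariance of the inner product under isometries that preserve weights *)

Section Isometries.
Variables (V W : wspace R) (dV : {dot V for idfun}) (dW : {dot W for idfun}).
Variable phi : 'Hom(V, W).
Hypotheses (phi_bij : bijective phi) (phi_wt : forall v, wt W (phi v) = wt V v)
  (phi_dot : forall u v, dW (phi u) (phi v) = dV u v).

Lemma isometry_neg : neg_weight V -> neg_weight W.
Proof.
case: phi_bij => psi psiK phiK nV w w0; rewrite -(phiK w) phi_wt nV //.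
by apply: contraNneq w0 => h; rewrite -(phiK w) h linear0.
Qed.

Lemma isometry_wt_values : wt_values (wt W) = wt_values (wt V).
Proof.
case: phi_bij => psi psiK phiK; have phi0 v : (phi v == 0) = (v == 0).
  by rewrite -(linear0 phi) (can_eq psiK).
apply/seteqP; split=> [_ [w w0 <-]|_ [v v0 <-]].
  exists (psi w); first by rewrite /= -phi0 phiK.
  by rewrite -phi_wt phiK.
by exists (phi v); rewrite //= phi0.
Qed.

Lemma isometry_sr : sr_map phi.
Proof.
move=> b psi hpsi; apply: wpoly_lin; split=> [c u v|v /hpsi.2]; last by rewrite phi_wt.
by rewrite /= linearP hpsi.1.
Qed.

(** The matrix of an isometry in adapted bases is block diagonal by depth: adaptedness bounds the
    weights one way, and the other way through the inverse, which is the transpose. *)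
Lemma isometry_matrix e e' : e \in adapted_basis dV -> e' \in adapted_basis dW ->
  dW e' (phi e) != 0 -> depth e' = depth e.
Proof.
move=> es es' h; have [psi psiK phiK] := phi_bij.
have := adapted_basis_wt es' h; rewrite phi_wt => h1.
have h2 : (wt V e <= wt V (psi e'))%E.
  by apply: (adapted_basis_wt es); rewrite -phi_dot phiK dotC.
have psi_wt : wt V (psi e') = wt W e' by rewrite -phi_wt phiK.
rewrite psi_wt in h2.
by rewrite /depth; congr (- fine _); apply/eqP; rewrite eq_le h1.
Qed.

(** [g] is arbitrary so that it can stand for the sum over the rest of a word, which depends on the
    first letter only through its depth. *)
Lemma isometry_kernel_sum (g : R -> R) x y :
  \sum_(e <- adapted_basis dW) g (depth e) * (dW e (phi x) * dW e (phi y)) =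
  \sum_(e <- adapted_basis dV) g (depth e) * (dV e x * dV e y).
Proof.
transitivity (\sum_(e <- adapted_basis dV) \sum_(e' <- adapted_basis dW)
    g (depth e) * dV e x * (dW e' (phi e) * dW e' (phi y))).
  rewrite exchange_big /= big_seq [RHS]big_seq; apply: eq_bigr => e' es'.
  have -> : dW e' (phi x) = \sum_(e <- adapted_basis dV) dV e x * dW e' (phi e).
    have hl : scalar (fun v => dW e' (phi v)).
      by move=> c u v; rewrite linearP; exact: dot_scalar.
    exact: (scalar_adapted_basis dV x hl).
  rewrite mulr_suml mulr_sumr big_seq [RHS]big_seq; apply: eq_bigr => e es.
  have [->|h] := eqVneq (dW e' (phi e)) 0; first by rewrite !(mul0r, mulr0).
  by rewrite (isometry_matrix es es' h); ring.
apply: eq_bigr => e _; rewrite -mulr_sumr -dot_adapted phi_dot.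
by rewrite mulrA.
Qed.

Lemma isometry_words n b x y :
  \sum_(w <- words (adapted_basis dW) n b) monomial dW w (phi x) * monomial dW w (phi y) =
  \sum_(w <- words (adapted_basis dV) n b) monomial dV w x * monomial dV w y.
Proof.
elim: n b => [|n IH] b; first by rewrite !big_seq1 /monomial !big_nil.
have E (U : wspace R) (d : {dot U for idfun}) u v :
    \sum_(w <- words (adapted_basis d) n.+1 b) monomial d w u * monomial d w v =
    1 + \sum_(e <- adapted_basis d) (if depth e <= b then
      \sum_(w <- words (adapted_basis d) n (b - depth e)) monomial d w u * monomial d w v
      else 0) * (d e u * d e v).
  rewrite words_sum {1 2}/monomial !big_nil mul1r; congr (_ + _).
  rewrite big_mkcond; apply: eq_bigr => e _; case: ifP => _; last by rewrite mul0r.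
  by rewrite mulr_suml; apply: eq_bigr => w _; rewrite !monomial_cons; ring.
rewrite !E; congr (_ + _); rewrite -(isometry_kernel_sum (fun a => if a <= b then
  \sum_(w <- words (adapted_basis dV) n (b - a)) monomial dV w x * monomial dV w y else 0)).
by apply: eq_bigr => e _; rewrite IH.
Qed.

Lemma isometry_lin_dot a b : neg_weight V ->
  lin_dot dW (lin_map phi a) (lin_map phi b) = lin_dot dV a b.
Proof.
move=> nV; have nW := isometry_neg nV.
have eM : max_depth W = max_depth V by rewrite /max_depth isometry_wt_values.
have LE v : lin_map phi (iota_of v) = iota_of (phi v).
  exact: lin_mapE nV eM isometry_sr.
have K x y : word_kernel dW (phi x) (phi y) = word_kernel dV x y.
  by rewrite /word_kernel /words_of eM /max_length isometry_wt_values isometry_words.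
have sc (A : lin W) : scalar (fun u => lin_dot dW A (lin_map phi u)).
  by move=> c u v; rewrite linearP; exact: dot_scalar.
apply: (lin_iota_scalar_ext (f := fun b => lin_dot dW (lin_map phi a) (lin_map phi b))
  (g := lin_dot dV a)) => [||y]; [exact: sc|exact: dot_scalar|].
rewrite (dotC (lin_dot dW)) (dotC (lin_dot dV)).
apply: (lin_iota_scalar_ext (f := fun a => lin_dot dW (lin_map phi (lin_iota y)) (lin_map phi a))
  (g := lin_dot dV (lin_iota y))) => [||x]; [exact: sc|exact: dot_scalar|].
by rewrite -![lin_iota _]/(iota_of _) !LE !lin_dot_iota.
Qed.

End Isometries.
End LinearizedInnerProduct.

(** * The hyperplane of negative weight and its complementary line *)

Section Hyperplane.
Context {R : realType}.
Implicit Types V W : wspace R.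

Lemma lin_wt_lt0 V (u : lin V) : (wt (lin V) u < 0)%E <-> lin_aug V u = 0.
Proof.
rewrite /= /hyperplane_wt; case: (eqVneq u 0) => [->|_].
  by split=> // _; rewrite linear0.
by case: eqVneq => [h|/eqP h]; split=> //; rewrite lte_fin ltxx.
Qed.

Lemma mem_neg_part V (u : lin V) : u \in neg_part (lin V) <-> lin_aug V u = 0.
Proof.
split=> [/wt_ltP[->|/lin_wt_lt0//]|h]; first exact: linear0.
by apply/wt_ltP; right; apply/lin_wt_lt0.
Qed.

Lemma neg_part_lker V : neg_part (lin V) = lker (lin_aug V).
Proof.
apply/vspaceP => u; rewrite memv_ker; apply/idP/eqP => [/mem_neg_part//|h].
exact/mem_neg_part.
Qed.

(** [lin_aug] has rank one: its target is a line and it takes the value [1] at [iota_of 0]. *)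
Lemma dim_neg_part V : neg_weight V -> (\dim (neg_part (lin V))).+1 = \dim {: lin V}.
Proof.
move=> nV; rewrite neg_part_lker -(limg_ker_dim (lin_aug V) fullv) capfv -addn1; congr (_ + _)%N.
apply/eqP; rewrite eq_sym eqn_leq; apply/andP; split.
  by apply: leq_trans (dimvS (subvf _)) _; rewrite dimvf.
rewrite lt0n dimv_eq0; apply/negP => /eqP h.
have := memv_img (lin_aug V) (memvf (iota_of (0 : V))).
by rewrite h memv0 lin_augE // oner_eq0.
Qed.

Lemma neg_part_cap_line V : neg_weight V ->
  (neg_part (lin V) :&: <[iota_of (0 : V)]> = 0)%VS.
Proof.
move=> nV; apply/eqP; rewrite -subv0; apply/subvP => x; rewrite memv_cap memv0.
move=> /andP[/mem_neg_part h /vlineP[c xE]]; move: h; rewrite xE linearZ /= lin_augE //.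
by rewrite -[c *: 1]/(c * 1) mulr1 => ->; rewrite scale0r.
Qed.

(** Subtracting [lin_aug V u *: iota_of 0] from [u] lands in the hyperplane, so hyperplane and line
    span everything. *)
Lemma neg_part_line V (u : lin V) : neg_weight V ->
  u - daddv_pi (neg_part (lin V)) <[iota_of (0 : V)]> u \in <[iota_of (0 : V)]>%VS.
Proof.
move=> nV; pose N := neg_part (lin V); pose l := <[iota_of (0 : V)]>%VS.
have uNl : u \in (N + l)%VS.
  apply/memv_addP; exists (u - lin_aug V u *: iota_of 0).
    apply/mem_neg_part; rewrite linearB linearZ /= lin_augE //.
    by rewrite -[_ *: 1]/(_ * 1) mulr1 subrr.
  exists (lin_aug V u *: iota_of 0); first by rewrite memvZ ?memv_line.
  by rewrite subrK.
rewrite -{1}(daddv_pi_add (neg_part_cap_line nV) uNl) addrC addKr.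
exact: memv_pi.
Qed.

(** [lin_map f] preserves the augmentation: both [lin_aug W \o lin_map f] and [lin_aug V] equal [1]
    on points. *)
Lemma lin_map_neg_part V W (f : V -> W) : neg_weight V -> neg_weight W ->
    max_depth W = max_depth V -> sr_map f ->
  (lin_map f @: neg_part (lin V) <= neg_part (lin W))%VS.
Proof.
move=> nV nW eM hf; apply/subvP => _ /memv_imgP[u /mem_neg_part hu ->].
apply/mem_neg_part; rewrite -hu.
apply: (lin_iota_scalar_ext (f := fun u => lin_aug W (lin_map f u)) (g := lin_aug V)).
- by move=> c x y; rewrite !linearP.
- exact: scalar_hom.
by move=> v; rewrite -[lin_iota v]/(iota_of v) lin_mapE // !lin_augE.
Qed.

Lemma quotient_lfun (V W QV QW : vectType R) (U : {vspace V}) (U' : {vspace W})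
    (piV : 'Hom(V, QV)) (piW : 'Hom(W, QW)) (T : 'Hom(V, W)) :
    quotient_map U piV -> quotient_map U' piW -> (forall v, v \in U -> T v \in U') ->
  exists M : 'Hom(QV, QW), forall v, M (piV v) = piW (T v).
Proof.
move=> [kV fV] [kW _] TU; exists (piW \o T \o piV^-1)%VF => v; rewrite !comp_lfunE /=.
apply/eqP; rewrite -subr_eq0 -linearB -linearB -memv_ker kW TU // -kV memv_ker linearB /=.
by rewrite limg_lfunVK ?subrr // memv_img ?memvf.
Qed.

End Hyperplane.

Theorem theorem4p1 (R : realType) :
  exists (bV : wspace R -> wspace R)
         (Pi : forall V : wspace R, 'Hom(bV V, V))
         (iota : forall V : wspace R, V -> bV V)
         (L : forall V W : wspace R, (V -> W) -> 'Hom(bV V, bV W))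
         (ip : forall V : wspace R, {dot V for idfun} -> {dot bV V for idfun}),
  let ell (V : wspace R) : {vspace bV V} := <[iota V 0%R]>%VS in
  forall V : wspace R, neg_weight V ->
  [/\ (forall v : bV V, (wt (bV V) v <= 0)%E),
      polynomial_map (iota V) &
  [/\ (* (1) *)
      (forall v : bV V, v \in neg_part (bV V) <-> (wt (bV V) v < 0)%E) /\
        (\dim (neg_part (bV V))).+1 = \dim {: bV V},
      (* (2) *)
      forall v, iota V v - iota V 0 \in neg_part (bV V),
      (* (3) *)
      forall f, PSR V V f -> forall v, iota V (f v) = L V V f (iota V v),
      (* (4) *)
      [/\ Lie_isomorphism (GSR V) (L V V),
          Lie_isomorphism (GSSR V) (L V V) &
          Lie_isomorphism (Gstar V) (L V V)] &
  [/\ (* (5) *)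
      [/\ L V V @` Gstar V `<=` L V V @` GSR V,
          L V V @` GSSR V `<=` L V V @` GSR V,
          unipotent (L V V @` Gstar V) &
          unipotent (L V V @` GSSR V)],
      (* (6) *)
      forall v, Pi V (iota V v) = v,
      (* (7) *)
      forall W : wspace R, compatible (wt V) (wt W) ->
      forall f, PSR V W f ->
        (forall v, iota W (f v) = L V W f (iota V v)) /\
        (L V W f @: neg_part (bV V) <= neg_part (bV W))%VS,
      (* (8) *)
      forall U W : wspace R,
        compatible (wt V) (wt U) -> compatible (wt V) (wt W) ->
      forall f g, PSR V W f -> PSR W U g ->
        L V U (g \o f) = (L W U g \o L V W f)%VF &
  [/\ (* (9) *)
      forall d : {dot V for idfun},
        [/\ ip V d (iota V 0) (iota V 0) = 1,
            forall u v, u \in ell V -> v \in neg_part (bV V) -> ip V d u v = 0 &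
            forall u v, ip V d (D0 (iota V) u) (D0 (iota V) v) = d u v],
      (* (9), canonicity: isomorphic data have isomorphic inner products *)
      forall (W : wspace R) (dV : {dot V for idfun}) (dW : {dot W for idfun})
             (phi : 'Hom(V, W)),
        bijective phi -> (forall v, wt W (phi v) = wt V v) ->
        (forall u v, dW (phi u) (phi v) = dV u v) ->
        forall a b, ip W dW (L V W phi a) (L V W phi b) = ip V dV a b &
      (* (10) *)
      forall W : wspace R, compatible (wt V) (wt W) ->
      forall f, PSR V W f -> f 0 = 0 ->
        (forall (QV QW : vectType R)
                (piV : 'Hom(bV V, QV)) (piW : 'Hom(bV W, QW)),
          quotient_map (ell V) piV -> quotient_map (ell W) piW ->
          exists M : 'Hom(QV, QW), forall v, M (piV v) = piW (L V W f v)) /\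
        (exists M : 'Hom(subvs_of (neg_part (bV V)), subvs_of (neg_part (bV W))),
          forall v, vsval (M (vsproj (neg_part (bV V))
                            (daddv_pi (neg_part (bV V)) (ell V) v))) =
                    daddv_pi (neg_part (bV W)) (ell W) (L V W f v))]]]].
Proof.
exists (@lin R), (@lin_proj R), (@iota_of R), (@lin_map R), (@lin_dot R) => /= V nV.
have neg W : compatible (wt V) (wt W) -> neg_weight W by move/compatible_neg; apply.
have eM W : compatible (wt V) (wt W) -> max_depth W = max_depth V.
  exact: max_depth_compatible.
have sr (U W : wspace R) (f : U -> W) : PSR U W f -> sr_map f by move/PSRP.
split; [by move=> u; exact: hyperplane_wt_le0|exact: polynomial_map_iota|split].
- split; last exact: dim_neg_part.
  by move=> v; split=> [/mem_neg_part/lin_wt_lt0|/lin_wt_lt0/mem_neg_part].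
- by move=> v; apply/mem_neg_part; rewrite linearB /= !lin_augE // subrr.
- by move=> f /sr hf v; rewrite lin_mapE.
- split.
  + rewrite GSR_subgroup //; apply: sr_subgroup_Lie => //.
    * exact: wpoly0.
    * exact: wpoly_add.
    * by move=> b k p; exact: wpoly_scale.
    * by move=> b p f hf; exact: wpoly_comp.
  + rewrite GSSR_subgroup //; apply: sr_subgroup_Lie => //.
    * by move=> b; exists 1 => //; exact: wpoly0.
    * exact: strictD.
    * by move=> b k p [dl dl0 hp]; exists dl => //; exact: wpoly_scale.
    * move=> b p [dl dl0 hp]; apply: wpoly_le hp; rewrite gerBl; exact: ltW.
    * by move=> b p f hf [dl dl0 hp]; exists dl => //; exact: wpoly_comp.
  + rewrite Gstar_subgroup //; apply: sr_subgroup_Lie => //.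
    * exact: star0.
    * exact: star_add.
    * by move=> b k p; exact: star_scale.
    * by move=> b p; exact: star_wpoly.
    * by move=> b p f hf; exact: star_comp.
split.
- have sS := GSSR_sub_Gstar (V := V); have sG := Gstar_sub_GSR nV.
  split.
  + exact: image_subset.
  + by apply: image_subset; exact: subset_trans sG.
  + by move=> _ [f hf <-]; exact: lin_map_unipotent.
  + by move=> _ [f /sS hf <-]; exact: lin_map_unipotent.
- by move=> v; rewrite lin_projE.
- move=> W cW f /sr hf; split; last exact: lin_map_neg_part nV (neg W cW) (eM W cW) hf.
  by move=> v; rewrite lin_mapE // eM.
- move=> U W cU cW f g /sr hf /sr hg.
  exact: lin_map_comp nV (neg W cW) (eM W cW) (eM U cU) hf hg.
split.
- move=> d; split; last by move=> u v; exact: lin_dot_D0.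
    by rewrite lin_dot_iota // word_kernel0.
  move=> _ v /vlineP[c ->] /mem_neg_part hv.
  by rewrite dotC dotZr dotC lin_dot_iota0 // hv mulr0.
- by move=> W dV dW phi hb hw hd a b; exact: isometry_lin_dot.
move=> W cW f /sr hf f0; have nW := neg W cW.
have L0 : lin_map f (iota_of 0) = iota_of 0 by rewrite lin_mapE ?eM // f0.
have Lline v : v \in <[iota_of (0 : V)]>%VS -> lin_map f v \in <[iota_of (0 : W)]>%VS.
  by move=> /vlineP[c ->]; rewrite linearZ /= L0 memvZ ?memv_line.
split; first by move=> QV QW piV piW hV hW; exact: quotient_lfun hV hW Lline.
set NV := neg_part (lin V); set NW := neg_part (lin W).
pose P := daddv_pi NW <[iota_of (0 : W)]>.
have [|M ME] := @linear_lfun R (subvs_of NV) (subvs_of NW)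
    (fun x => vsproj NW (P (lin_map f (vsval x)))).
  by move=> c x y; rewrite !linearP.
exists M => v; rewrite ME !vsprojK ?memv_pi //.
set x := daddv_pi NV _ v; have xv : v - x \in <[iota_of (0 : V)]>%VS by exact: neg_part_line.
(* The difference of the two projections lies in the hyperplane and, since [lin_map f] maps line to
   line, also in the line; these meet in [0]. *)
apply/eqP; rewrite -subr_eq0 -memv0 -(neg_part_cap_line nW) memv_cap rpredB ?memv_pi //=.
have -> : P (lin_map f x) - P (lin_map f v) =
    (lin_map f v - P (lin_map f v)) - (lin_map f x - P (lin_map f x)) - lin_map f (v - x).
  rewrite [lin_map f (v - x)]linearB.
  by apply: scalar_separates => psi /scalar_lin[_ _ psiB _ _]; rewrite !psiB; ring.
by apply: rpredB; [apply: rpredB; exact: neg_part_line|exact: Lline].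
Qed.
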